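(* Let $0<\alpha<1$ and $\theta\ge0$, and let $(T_n^{\alpha,\theta},n\ge1)$ be an $(\alpha,\theta)$-tree growth process. Then for every $k\ge1$, $$n^{-\alpha}R(T_n^{\alpha,\theta},[k])\to\mathcal{R}_k^{\alpha,\theta}\qquad\text{almost surely as }n\to\infty,$$ in the sense that the $2k-1$ edge lengths of $R(T_n^{\alpha,\theta},[k])$, multiplied by $n^{-\alpha}$, converge almost surely as $n\to\infty$ to (finite, random) limiting edge lengths of a tree $\mathcal{R}_k^{\alpha,\theta}$.
   Context: Trees. $[n]=\{1,\dots,n\}$. $\mathbb{T}_{[n]}$ is the set of rooted binary trees with $n$ leaves labeled by $[n]$: the root and the leaves have degree 1, all other vertices (branch points) have degree 3; there are $2n-1$ edges. The root edge of a tree is the edge adjacent to its root. For $n\ge2$ a tree splits at the branch point adjacent to the root into two subtrees, each of which is rooted at that branch point (so each subtree has its own root edge, starting at that branch point). $(\alpha,\theta)$-tree growth process ($0\le\alpha\le1$, $\theta\ge0$). $T_1$ is a single edge joining the root and leaf 1. $T_2$ is the Y-shaped tree with root, one branch point and leaves 1, 2. For $n\ge2$, given $T_1,\dots,T_n$, an edge $a_n\to c_n$ of $T_n$ (directed away from the root) is selected at random as described below, and $T_{n+1}$ is obtained by replacing it by three edges $a_n\to b_n$, $b_n\to c_n$, $b_n\to n+1$, where $b_n$ is a new branch point and $n+1$ a new leaf. Selection rule: let the two subtrees of $T_n$ above the branch point adjacent to the root be $T_{n,0}$ with $m$ leaves and $T_{n,1}$ with $n-m$ leaves, where $T_{n,1}$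 contains the smallest leaf label of $T_n$. Assign weight $\alpha$ to the root edge, $m-\alpha$ to $T_{n,0}$ and $n-m-1+\theta$ to $T_{n,1}$. Choose the root edge or one of the subtrees with probability proportional to these weights. If a subtree with at least two leaves was chosen, apply the same procedure recursively to that subtree (with its own root edge, number of leaves and smallest label), until a root edge or a subtree with a single leaf is chosen; in the latter case the unique edge of this subtree is selected. Reduced trees. For $n\ge k$, $R(T_n,[k])$ is the tree $T_k$ with edge lengths defined as follows: by the growth procedure each vertex of $T_k$ is also a vertex of $T_n$, and each edge of $T_k$ is given as length the graph distance in $T_n$ between its two end vertices. The limit $\mathcal{R}_k$ has combinatorial shape $T_k$ (limiting edge lengths are allowed to be zero; this happens for some leaf edges when $\theta=0$). *)

(* Defs.v *)
From HB Require Import structures.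
From mathcomp Require Import all_boot all_order all_algebra.
From mathcomp Require Import all_classical all_reals all_analysis.

Set Implicit Arguments.
Unset Strict Implicit.
Unset Printing Implicit Defensive.

Import Order.TTheory GRing.Theory Num.Theory.
Import numFieldNormedType.Exports.

Local Open Scope classical_set_scope.
Local Open Scope ring_scope.

(* [VBranch n] is b_n, the branch point created when leaf n+1 is attached:
   vertices keep their names while the tree grows, so that a vertex of T_k is
   literally a vertex of T_n for n >= k. *)
Inductive vertex := VRoot | VLeaf of nat | VBranch of nat.

Definition vertex_encode (v : vertex) : option (nat + nat) :=
  match v with
  | VRoot => None
  | VLeaf j => Some (inl j)
  | VBranch n => Some (inr n)
  end.

Definition vertex_decode (x : option (nat + nat)) : vertex :=
  match x with
  | None => VRoot
  | Some (inl j) => VLeaf j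
  | Some (inr n) => VBranch n
  end.

Lemma vertex_encodeK : cancel vertex_encode vertex_decode.
Proof. by case. Qed.

HB.instance Definition _ := Countable.copy vertex (can_type vertex_encodeK).

(* A [tree] is a rooted tree without its root vertex: the root edge is the one
   that enters [top t] from below.  The order of the two subtrees in [TNode]
   carries no meaning, nothing below depends on it. *)
Inductive tree := TLeaf of nat | TNode of nat & tree & tree.

Definition top (t : tree) : vertex :=
  match t with TLeaf j => VLeaf j | TNode b _ _ => VBranch b end.

Fixpoint nleaves (t : tree) : nat :=
  match t with TLeaf _ => 1 | TNode _ s s' => (nleaves s + nleaves s')%N end.

Fixpoint min_label (t : tree) : nat :=
  match t with
  | TLeaf j => j
  | TNode _ s s' => minn (min_label s) (min_label s')
  end.

Definition edge : Type := (vertex * vertex)%type.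

(* Edges a -> c, directed away from the root, of [t] planted at [a]. *)
Fixpoint edges_from (a : vertex) (t : tree) : seq edge :=
  (a, top t) ::
  match t with
  | TLeaf _ => [::]
  | TNode b s s' => edges_from (VBranch b) s ++ edges_from (VBranch b) s'
  end.

Definition edges (t : tree) : seq edge := edges_from VRoot t.

Definition adjacent (t : tree) : rel vertex :=
  fun u v => ((u, v) \in edges t) || ((v, u) \in edges t).

(* Length of a shortest path; a tree has one more vertex than edges, so a
   shortest path between two vertices has length at most [size (edges t)].
   Junk value [(size (edges t)).+1] if [u] and [v] are not joined by a path. *)
Definition graph_dist (t : tree) (u v : vertex) : nat :=
  find (fun m => `[< exists p : seq vertex,
                       [/\ path (adjacent t) u p, last u p = v & size p = m] >])
       (iota 0 (size (edges t)).+1).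

(* Length in R(T_n, [k]) of an edge [e] of T_k, with [t] = T_n. *)
Definition reduced_length (t : tree) (e : edge) : nat := graph_dist t e.1 e.2.

(* Replaces the edge a -> c of [t] by a -> b_n, b_n -> c and b_n -> n+1. *)
Fixpoint graft (n : nat) (c : vertex) (t : tree) : tree :=
  if top t == c then TNode n t (TLeaf n.+1)
  else match t with
       | TLeaf _ => t
       | TNode b s s' => TNode b (graft n c s) (graft n c s')
       end.

Definition subtree_weight (R : realType) (alpha theta : R) (m : nat)
    (has_min_label : bool) : R :=
  if has_min_label then m%:R - 1 + theta else m%:R - alpha.

(* Probability that the recursive selection rule, run on [t], selects the edge
   of [t] whose end vertex is [c]. *)
Fixpoint select_prob (R : realType) (alpha theta : R) (t : tree) (c : vertex)
    : R :=
  match t with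
  | TLeaf j => (c == VLeaf j)%:R
  | TNode b s s' =>
      let w := subtree_weight alpha theta (nleaves s)
                 (min_label s < min_label s')%N in
      let w' := subtree_weight alpha theta (nleaves s')
                 (min_label s' < min_label s)%N in
      (alpha * (c == VBranch b)%:R + w * select_prob alpha theta s c
       + w' * select_prob alpha theta s' c) / (alpha + w + w')
  end.

Section TreeGrowth.
Context (d : measure_display) (R : realType) (Omega : measurableType d).
Variable P : probability Omega R.

(* The process is indexed from 1, [T 0] is irrelevant.  Since [tree] is
   countable, measurability of the events T_n = t is measurability of T_n for
   the discrete sigma-algebra.  Distinct edges of T_n give distinct values of
   T_{n+1}, so the last clause is the conditional law of the selected edge given
   T_1, ..., T_n. *)
Definition tree_growth_process (alpha theta : R) (T : nat -> Omega -> tree) :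
    Prop :=
  [/\ (forall n t, (1 <= n)%N -> measurable [set w | T n w = t]),
      (forall w, T 1%N w = TLeaf 1),
      (forall w, T 2%N w = TNode 1 (TLeaf 1) (TLeaf 2))
    & forall (n : nat) (h : nat -> tree) (e : edge),
        (2 <= n)%N -> e \in edges (h n) ->
        let past := [set w | forall i, (1 <= i <= n)%N -> T i w = h i] in
        P (past `&` [set w | T n.+1 w = graft n e.2 (h n)])
        = (P past * (select_prob alpha theta (h n) e.2)%:E)%E].

End TreeGrowth.

(* Main.v *)
Require Import Defs.
From HB Require Import structures.
From mathcomp Require Import all_boot all_order all_algebra.
From mathcomp Require Import all_classical all_reals all_analysis.
From mathcomp Require Import measurable_realfun zify ring lra.

Import Order.TTheory GRing.Theory Num.Theory.
Import numFieldNormedType.Exports.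

Set Implicit Arguments.
Unset Strict Implicit.
Unset Printing Implicit Defensive.

Local Open Scope classical_set_scope.
Local Open Scope ring_scope.

(** The proof writes each edge length as a function of a nonnegative
supermartingale and of a convergent fraction of leaves.

Let [t0] be the value of T_k.  For n >= k the tree T_n is [t0] with further
subtrees hung along its edges ([extends]), so each edge e = (a, c) of [t0] has
become a path, its spine, inside the subtree S_n of T_n planted at a that
contains c ([planted]), and the reduced length of e is the number d_n of edges
of that spine ([graph_dist_spine]).

The labels of hung leaves exceed k, so at every branch point of the spine the
side of c holds the smallest label.  A side with n1 leaves that holds the
smallest label is chosen with weight n1 - 1 + theta, and n1 - 1 + theta is also
the normalising constant of the selection inside that side.  The probabilities
along the spine therefore telescope: given that the new leaf falls into S_n,
which has N_n >= 2 leaves, it falls onto the spine with probability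
(alpha d_n + c0) / (N_n - 1 + theta), where c0 = 0 if c is a branch point and
c0 = theta - alpha if c is a leaf, and it falls into a given one of the two
subtrees above c with the weight of that subtree divided by N_n - 1 + theta
([mean_graft_spine_leaf], [mean_graft_spine_branch]).  Two consequences follow.

The weight of a subtree above c divided by N_n - 1 + theta is a martingale
([mean_graft_fraction]).  By induction from the root, N_n / n converges almost
surely for every edge ([planted_nleaves_cvg]).

The ratio (alpha d_n + c0) / (N_n - 2 + theta + alpha) ^ alpha is a
supermartingale ([mean_graft_spine_potential]), by Bernoulli's inequality; the
shift in the denominator makes that inequality point in the right direction.
It converges almost surely, and multiplying it by
((N_n - 2 + theta + alpha) / n) ^ alpha, which converges too, gives the limit of
n ^ (- alpha) d_n ([cvg_spine_length]).

Both steps use that a nonnegative supermartingale converges almost surely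
([supermartingale_cvg]).  It is proved for filtrations generated by countable
partitions, here by the history T_1, ..., T_n: someone who buys a share whenever
the price is at most a and sells it whenever the price is at least b earns at
least b - a per upcrossing, while the mean wealth never exceeds the initial
capital a. *)

(** * Vertices of a tree and grafting *)

Fixpoint verts (t : tree) : seq vertex :=
  top t :: match t with
           | TLeaf _ => [::]
           | TNode _ s s' => verts s ++ verts s'
           end.

Lemma verts_edges a t : [seq e.2 | e <- edges_from a t] = verts t.
Proof. by elim: t a => [j|b s IHs s' IHs'] a //=; rewrite map_cat IHs IHs'. Qed.

Lemma top_verts t : top t \in verts t.
Proof. by case: t => *; rewrite /= inE eqxx. Qed.

Lemma nleaves_gt0 t : (0 < nleaves t)%N.
Proof. by elim: t => //= b s IHs s' IHs'; lia. Qed.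

Lemma min_label_verts t : VLeaf (min_label t) \in verts t.
Proof.
elim: t => [j|b s IHs s' IHs'] /=; first by rewrite inE.
rewrite inE mem_cat; case: leqP => _; first by rewrite IHs orbT.
by rewrite IHs' !orbT.
Qed.

Lemma graft_notin n v t : v \notin verts t -> graft n v t = t.
Proof.
elim: t => [j|b s IHs s' IHs'] /=; rewrite inE; first by rewrite eq_sym => /negbTE ->.
rewrite mem_cat !negb_or eq_sym => /and3P[/negbTE -> vs vs'].
by rewrite IHs // IHs'.
Qed.

Lemma uniq_verts_node b s s' : uniq (verts (TNode b s s')) ->
  [/\ VBranch b \notin verts s, VBranch b \notin verts s',
      uniq (verts s), uniq (verts s') & ~~ has (mem (verts s)) (verts s')].
Proof. by rewrite /= mem_cat negb_or cat_uniq => /and4P[/andP[-> ->] -> -> ->]. Qed.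

Lemma graft_node n v b s s' : uniq (verts (TNode b s s')) ->
  v \in verts (TNode b s s') ->
  graft n v (TNode b s s') =
    if v == VBranch b then TNode n (TNode b s s') (TLeaf n.+1)
    else if v \in verts s then TNode b (graft n v s) s'
    else TNode b s (graft n v s').
Proof.
move=> /uniq_verts_node[bs bs' us us' ss'].
rewrite /= [VBranch b == v]eq_sym inE mem_cat; case: eqP => //= _.
case: ifP => vs /=; last by move=> _; rewrite (graft_notin n (negbT vs)).
move=> _; rewrite (@graft_notin n v s') //.
by apply/negP => vs'; move/hasP: ss'; apply; exists v.
Qed.

Lemma nleaves_graft n v t : uniq (verts t) -> v \in verts t ->
  nleaves (graft n v t) = (nleaves t).+1.
Proof.
elim: t => [j|b s IHs s' IHs'] ut vt.
  by move: vt; rewrite /= inE eq_sym => ->.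
rewrite graft_node //; have [_ _ us us' _] := uniq_verts_node ut.
move: vt; rewrite /= inE mem_cat; case: eqP => [_ _|_ /=].
  by rewrite /= addn1.
case: ifP => vs /= vs'; first by rewrite IHs.
by rewrite IHs' // addnS.
Qed.

(** The grafted edge is recognised in the new tree as the one that now carries the
branch point n, hence the freshness of n. *)
Lemma graft_inj n v v' t : uniq (verts t) -> VBranch n \notin verts t ->
  v \in verts t -> v' \in verts t -> graft n v t = graft n v' t -> v = v'.
Proof.
elim: t => [j|b s IHs s' IHs'] ut nt vt v't.
  by move: vt v't; rewrite /= !inE => /eqP -> /eqP ->.
have [bs bs' us us' ss'] := uniq_verts_node ut.
rewrite !graft_node //; move: nt vt v't.
rewrite /= !inE mem_cat !negb_or !mem_cat => /and3P[/eqP nb ns ns'].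
have nb' : n <> b by move=> h; apply: nb; rewrite h.
case: eqP => [->|_] /= vt.
  case: eqP => [->//|_] /= _; by case: ifP => _ [] /nb'.
case: eqP => [->|_] /= v't; first by case: ifP => _ [] /esym /nb'.
case: ifP vt => vs /= vt; case: ifP v't => v's /= v't [].
- by apply: IHs.
- by move=> /(congr1 nleaves); rewrite nleaves_graft // => /eqP; rewrite eqn_leq ltnn.
- move=> /(congr1 nleaves); rewrite [RHS]nleaves_graft // => /eqP.
  by rewrite eqn_leq ltnn andbF.
- by apply: IHs'.
Qed.

Lemma perm_verts_graft n v t : uniq (verts t) -> v \in verts t ->
  perm_eq (verts (graft n v t)) [:: VBranch n, VLeaf n.+1 & verts t].
Proof.
elim: t => [j|b s IHs s' IHs'] ut vt; apply/permP => p.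
  by move: vt; rewrite /= inE eq_sym => -> /=; rewrite !addn0; congr addn; rewrite addnC.
rewrite graft_node //; have [_ _ us us' _] := uniq_verts_node ut.
move: vt; rewrite [verts (TNode b s s')]/= inE mem_cat; case: eqP => [_ _|_ /=].
  rewrite /= !count_cat /= ?count_cat; ring.
case: ifP => vs /= vs'; rewrite !count_cat.
  rewrite (permP (IHs us vs)) /=; ring.
rewrite (permP (IHs' us' vs')) /=; ring.
Qed.

(** The vertices that can occur in T_n, apart from the root. *)
Definition named_by (n : nat) (v : vertex) : bool :=
  match v with VRoot => false | VLeaf j => (j <= n)%N | VBranch b => (b < n)%N end.

Inductive grown : nat -> tree -> Prop :=
| GrownLeaf : grown 1 (TLeaf 1)
| GrownGraft n t v : grown n t -> v \in verts t -> grown n.+1 (graft n v t).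

Lemma grown_wf n t : grown n t ->
  [/\ uniq (verts t), nleaves t = n & all (named_by n) (verts t)].
Proof.
elim=> {n t} [|n t v _ [ut nt bt] vt]; first by split.
have pt := @perm_verts_graft n _ _ ut vt; split.
- rewrite (perm_uniq pt) /= ut inE /= andbT; apply/andP; split.
    by apply/negP => /(allP bt) /=; lia.
  by apply/negP => /(allP bt) /=; lia.
- by rewrite nleaves_graft // nt.
- rewrite (perm_all _ pt) /= !leqnn /=.
  by apply: sub_all bt => -[|j|b] //=; lia.
Qed.
(** * Trees that extend a given tree *)

Definition fresh (k : nat) (v : vertex) : bool := ~~ named_by k v.

(** A new leaf is always grafted as a right child, so everything hung on an edge of
the initial tree hangs to the right and the path that replaces this edge goes
left. *)
Inductive extends (k : nat) : tree -> tree -> Prop :=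
| ExtendsLeaf j : extends k (TLeaf j) (TLeaf j)
| ExtendsNode b s0 s0' s s' : extends k s0 s -> extends k s0' s' ->
    extends k (TNode b s0 s0') (TNode b s s')
| ExtendsHang t0 b s s' : extends k t0 s -> fresh k (VBranch b) ->
    all (fresh k) (verts s') -> extends k t0 (TNode b s s').

Lemma extends_refl k t : extends k t t.
Proof. by elim: t => [j|b s IHs s' IHs']; constructor. Qed.

Lemma extends_graft k t0 t n v : extends k t0 t -> uniq (verts t) ->
  v \in verts t -> (k <= n)%N -> extends k t0 (graft n v t).
Proof.
move=> + + + kn; elim=> {t0 t} [j|b s0 s0' s s' es IHs es' IHs'|t0 b s s' es IHs fb fs'] ut vt.
- move: vt; rewrite /= inE eq_sym => ->.
  by apply: ExtendsHang; rewrite /fresh /= ?andbT -?leqNgt -?ltnNge //; apply: ExtendsLeaf.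
- rewrite graft_node //; have [_ _ us us' _] := uniq_verts_node ut.
  move: vt; rewrite [verts _]/= inE mem_cat; case: eqP => [_ _|_ /=].
    apply: ExtendsHang; first exact: ExtendsNode.
      by rewrite /fresh /= -leqNgt.
    by rewrite /fresh /= andbT -ltnNge ltnS.
  by case: ifP => vs /= vs'; apply: ExtendsNode; auto.
- rewrite graft_node //; have [_ _ us us' _] := uniq_verts_node ut.
  move: vt; rewrite [verts _]/= inE mem_cat; case: eqP => [_ _|_ /=].
    apply: ExtendsHang; first exact: ExtendsHang.
      by rewrite /fresh /= -leqNgt.
    by rewrite /fresh /= andbT -ltnNge ltnS.
  case: ifP => vs /= vs'; apply: ExtendsHang => //; first by auto.
  rewrite (perm_all _ (perm_verts_graft n us' vs')) /= fs' andbT.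
  by rewrite /fresh /= -leqNgt kn.
Qed.

(** Hung leaves carry labels above k; this is why the spine side of a branch point
always holds the smallest label. *)
Lemma extends_min_label k t0 t : extends k t0 t -> all (named_by k) (verts t0) ->
  min_label t = min_label t0.
Proof.
elim=> {t0 t} [//|b s0 s0' s s' _ IHs _ IHs'|t0 b s s' _ IHs _ fs'] /=.
  by rewrite all_cat => /and3P[_ /IHs -> /IHs' ->].
move=> nt0; rewrite IHs //; apply/minn_idPl.
have /= := allP nt0 _ (min_label_verts t0).
have := allP fs' _ (min_label_verts s'); rewrite /fresh /= -ltnNge => h1 h2.
exact: leq_trans h2 (ltnW h1).
Qed.

Lemma extends_leaf_inv k j t : extends k (TLeaf j) t ->
  t = TLeaf j \/ exists b s s', [/\ t = TNode b s s', extends k (TLeaf j) s,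
    fresh k (VBranch b) & all (fresh k) (verts s')].
Proof.
move=> e; inversion e; first by left.
by right; exists b, s, s'.
Qed.

Lemma extends_node_inv k b s0 s0' t : extends k (TNode b s0 s0') t ->
  (exists s s', [/\ t = TNode b s s', extends k s0 s & extends k s0' s']) \/
  (exists c s s', [/\ t = TNode c s s', extends k (TNode b s0 s0') s,
    fresh k (VBranch c) & all (fresh k) (verts s')]).
Proof.
move=> e; inversion e; first by left; exists s, s'.
by right; exists b0, s, s'.
Qed.

(** For a tree that extends a node with branch point b, the subtrees above b are
found by descending left until b is met; the value at a leaf is junk. *)
Fixpoint left_at (b : nat) (t : tree) : tree :=
  match t with
  | TLeaf _ => t
  | TNode c s _ => if c == b then s else left_at b s
  end.

Fixpoint right_at (b : nat) (t : tree) : tree :=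
  match t with
  | TLeaf _ => t
  | TNode c s s' => if c == b then s' else right_at b s
  end.

(** Distance to v from the vertex at which t is planted, when v is a branch point on the
leftmost path of t or the leaf at its end. *)
Fixpoint spine_length (v : vertex) (t : tree) : nat :=
  match t with
  | TLeaf _ => 1
  | TNode c s _ => if VBranch c == v then 1 else (spine_length v s).+1
  end.

Lemma uniq_left_at b t : uniq (verts t) -> uniq (verts (left_at b t)).
Proof.
elim: t => [//|c s IHs s' _] /uniq_verts_node[_ _ us _ _] /=.
by case: eqP => _ //; apply: IHs.
Qed.

Lemma uniq_right_at b t : uniq (verts t) -> uniq (verts (right_at b t)).
Proof.
elim: t => [//|c s IHs s' _] /uniq_verts_node[_ _ us us' _] /=.
by case: eqP => _ //; apply: IHs.
Qed.

Lemma extends_at k b s0 s0' t : named_by k (VBranch b) ->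
  extends k (TNode b s0 s0') t ->
  extends k s0 (left_at b t) /\ extends k s0' (right_at b t).
Proof.
move=> nb; elim: t => [j|c s IHs s' _] /extends_node_inv[].
- by case=> s [s' []].
- by case=> c [s [s' []]].
- by case=> _ [_ [[-> <- <-]]] /=; rewrite eqxx.
- case=> _ [_ [_ [[<- <- <-]]]] /= e fc _; case: eqP fc => [->|_ _]; last exact: IHs.
  by rewrite /fresh nb.
Qed.

(** * The mean of a function of the tree after one growth step *)

Section MeanGraft.
Variables (R : realType) (alpha theta : R).
Hypothesis theta0 : 0 <= theta.
Implicit Types (t s : tree) (phi psi : tree -> R).

Definition weight (s s' : tree) : R :=
  subtree_weight alpha theta (nleaves s) (min_label s < min_label s')%N.

(** Conditional expectation of phi(T_{n+1}) given T_n = t.  Computing it by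
recursion on t, as in the selection rule, replaces sums over the edges by
inductions on t; [mean_graftE] is the link with [select_prob]. *)
Fixpoint mean_graft (n : nat) (t : tree) (phi : tree -> R) : R :=
  let root_edge := phi (TNode n t (TLeaf n.+1)) in
  match t with
  | TLeaf _ => root_edge
  | TNode b s s' =>
      (alpha * root_edge + weight s s' * mean_graft n s (fun x => phi (TNode b x s'))
       + weight s' s * mean_graft n s' (fun x => phi (TNode b s x)))
      / (alpha + weight s s' + weight s' s)
  end.

Lemma select_prob_notin t v : v \notin verts t -> select_prob alpha theta t v = 0.
Proof.
elim: t => [j|b s IHs s' IHs'] /=; rewrite inE; first by move=> /negbTE ->.
by rewrite mem_cat !negb_or => /and3P[/negbTE -> /IHs -> /IHs' ->]; rewrite !mulr0 !addr0 mul0r.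
Qed.

Lemma select_prob_node b s s' v : uniq (verts (TNode b s s')) ->
  v \in verts (TNode b s s') ->
  select_prob alpha theta (TNode b s s') v =
   (if v == VBranch b then alpha
    else if v \in verts s then weight s s' * select_prob alpha theta s v
    else weight s' s * select_prob alpha theta s' v) / (alpha + weight s s' + weight s' s).
Proof.
move=> /uniq_verts_node[bs bs' us us' ss'] vt; rewrite [LHS]/=; congr (_ / _).
case: eqP vt => [-> _|_]; first by rewrite !select_prob_notin // !mulr0 !addr0 mulr1.
rewrite mulr0 add0r; case: ifP => [vs _|/negbT vs _].
  rewrite [select_prob _ _ s' _]select_prob_notin ?mulr0 ?addr0 //.
  by apply/negP => vs'; move/hasP: ss'; apply; exists v.
by rewrite [select_prob _ _ s _]select_prob_notin // mulr0 add0r.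
Qed.

Lemma mean_graftE n t phi : uniq (verts t) ->
  mean_graft n t phi = \sum_(v <- verts t) select_prob alpha theta t v * phi (graft n v t).
Proof.
elim: t phi => [j|b s IHs s' IHs'] phi ut.
  by rewrite /= big_seq1 !eqxx mul1r.
have [bs bs' us us' ss'] := uniq_verts_node ut.
rewrite [LHS]/= IHs // IHs' // [verts _]/= big_cons big_cat.
rewrite [LHS]mulrDl [X in X + _ = _]mulrDl -addrA; congr (_ + (_ + _)).
- by rewrite select_prob_node ?(top_verts (TNode b s s')) //= !eqxx mulrAC.
- rewrite mulr_sumr mulr_suml !big_seq; apply: eq_bigr => v vs.
  have vt : v \in verts (TNode b s s') by rewrite /= inE mem_cat vs orbT.
  have vb : v == VBranch b = false by apply: contraNF bs => /eqP <-.
  by rewrite select_prob_node // graft_node // vb vs mulrA mulrAC.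
- rewrite mulr_sumr mulr_suml !big_seq; apply: eq_bigr => v vs.
  have vt : v \in verts (TNode b s s') by rewrite /= inE mem_cat vs !orbT.
  have vb : v == VBranch b = false by apply: contraNF bs' => /eqP <-.
  have vs0 : v \in verts s = false.
    by apply/negP => v0; move/hasP: ss'; apply; exists v.
  by rewrite select_prob_node // graft_node // vb vs0 mulrA mulrAC.
Qed.

Lemma eq_mean_graft n t phi psi : uniq (verts t) ->
  (forall v, v \in verts t -> phi (graft n v t) = psi (graft n v t)) ->
  mean_graft n t phi = mean_graft n t psi.
Proof.
move=> ut h; rewrite !mean_graftE // !big_seq; apply: eq_bigr => v vt; by rewrite h.
Qed.

(** Exactly one side holds the smallest label, whichever it is, so the total weight
depends on the number of leaves only. *)
Lemma weight_sum b s s' : uniq (verts (TNode b s s')) ->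
  alpha + weight s s' + weight s' s = (nleaves (TNode b s s'))%:R - 1 + theta.
Proof.
move=> /uniq_verts_node[_ _ _ _ ss'].
rewrite /weight /subtree_weight /= natrD.
case: (ltngtP (min_label s) (min_label s')) => [_|_|e]; try ring.
exfalso; move/hasP: ss'; apply; exists (VLeaf (min_label s')).
  exact: min_label_verts.
by rewrite -e; apply: min_label_verts.
Qed.

Lemma node_denominator_gt0 b s s' : 0 < (nleaves (TNode b s s'))%:R - 1 + theta.
Proof.
have h : 1 <= (nleaves s)%:R :> R by rewrite ler1n nleaves_gt0.
have h' : 1 <= (nleaves s')%:R :> R by rewrite ler1n nleaves_gt0.
by rewrite /= natrD; move: theta0; lra.
Qed.

Lemma mean_graft_node n b s s' phi : uniq (verts (TNode b s s')) ->
  ((nleaves (TNode b s s'))%:R - 1 + theta) * mean_graft n (TNode b s s') phi =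
  alpha * phi (TNode n (TNode b s s') (TLeaf n.+1))
   + weight s s' * mean_graft n s (fun x => phi (TNode b x s'))
   + weight s' s * mean_graft n s' (fun x => phi (TNode b s x)).
Proof.
move=> ut; rewrite [mean_graft _ _ _]/= -(weight_sum ut) mulrC divfK //.
by rewrite (weight_sum ut) gt_eqF // node_denominator_gt0.
Qed.

(** The selection probabilities sum to 1. *)
Lemma mean_graft_cst n t c : uniq (verts t) -> mean_graft n t (fun=> c) = c.
Proof.
elim: t => [//|b s IHs s' IHs'] ut.
have [_ _ us us' _] := uniq_verts_node ut.
have e := mean_graft_node n (fun=> c) ut; rewrite IHs // IHs' // in e.
apply: (@mulfI _ ((nleaves (TNode b s s'))%:R - 1 + theta)).
  by rewrite gt_eqF // node_denominator_gt0.
by rewrite e -(weight_sum ut); ring.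
Qed.

Lemma mean_graft_nleaves n t (G : nat -> R) : uniq (verts t) ->
  mean_graft n t (fun x => G (nleaves x)) = G (nleaves t).+1.
Proof.
move=> ut; rewrite -[RHS](mean_graft_cst n _ ut); apply: eq_mean_graft => // v vt.
by rewrite nleaves_graft.
Qed.

Lemma weight_hang k t0 s s' : extends k t0 s -> all (named_by k) (verts t0) ->
  all (fresh k) (verts s') ->
  weight s s' = (nleaves s)%:R - 1 + theta /\ weight s' s = (nleaves s')%:R - alpha.
Proof.
move=> e nt0 fs'; rewrite /weight /subtree_weight.
rewrite (extends_min_label e nt0).
have /= h1 := allP nt0 _ (min_label_verts t0).
have := allP fs' _ (min_label_verts s'); rewrite /fresh /= -ltnNge => h2.
have h3 : (min_label t0 < min_label s')%N by apply: leq_ltn_trans h2.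
by rewrite h3 ltnNge ltnW.
Qed.

(** The weights along the spine telescope.  When t is the single leaf j, both sides
reduce to theta times the only possible value, so that theta = 0 needs no
separate treatment. *)
Lemma mean_graft_spine_leaf k j t n (G : nat -> nat -> R) :
  extends k (TLeaf j) t -> named_by k (VLeaf j) -> uniq (verts t) ->
  ((nleaves t)%:R - 1 + theta) *
    mean_graft n t (fun x => G (nleaves x) (spine_length (VLeaf j) x)) =
  (alpha * ((spine_length (VLeaf j) t)%:R - 1) + theta) *
    G (nleaves t).+1 (spine_length (VLeaf j) t).+1
  + ((nleaves t)%:R - 1 - alpha * ((spine_length (VLeaf j) t)%:R - 1)) *
    G (nleaves t).+1 (spine_length (VLeaf j) t).
Proof.
move=> + nj; elim: t G => [i|b s IHs s' _] G e ut.
  by rewrite /=; ring.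
case: (extends_leaf_inv e) => // -[_ [_ [_ [[<- <- <-] es fb fs']]]].
have [_ _ us us' _] := uniq_verts_node ut.
have nt0 : all (named_by k) (verts (TLeaf j)) by rewrite /= andbT.
have [w w'] := weight_hang es nt0 fs'.
rewrite mean_graft_node //= w w'.
rewrite (IHs (fun N d => G (N + nleaves s')%N d.+1)) //.
(* a graft inside the hung subtree s' only changes the number of leaves *)
rewrite (@mean_graft_nleaves n s' (fun N => G (nleaves s + N)%N (spine_length (VLeaf j) s).+1)) //.
rewrite addn1 addnS ?addSn.
rewrite natrD -natr1; ring.
Qed.

(** Telescoping again, now for a branch point b: each of the d spine edges has weight
alpha, the two subtrees above b keep the weights they have at b, and the rest of
the mass falls into the hung subtrees, where only the number of leaves
changes. *)
Lemma mean_graft_spine_branch k b s0 s0' t n (G : nat -> nat -> tree -> tree -> R) :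
  extends k (TNode b s0 s0') t -> all (named_by k) (verts (TNode b s0 s0')) ->
  uniq (verts t) -> (k <= n)%N ->
  let l := left_at b t in let r := right_at b t in
  let N := nleaves t in let d := spine_length (VBranch b) t in
  (N%:R - 1 + theta) * mean_graft n t (fun x =>
    G (nleaves x) (spine_length (VBranch b) x) (left_at b x) (right_at b x)) =
  alpha * d%:R * G N.+1 d.+1 l r
  + weight l r * mean_graft n l (fun x => G N.+1 d x r)
  + weight r l * mean_graft n r (fun x => G N.+1 d l x)
  + (N%:R - 1 + theta - alpha * d%:R - weight l r - weight r l) * G N.+1 d l r.
Proof.
move=> + nt0 + kn.
have nb : named_by k (VBranch b) by move: nt0 => /= /andP[].
have bn : (n == b) = false.
  by apply/negP => /eqP h; move: nb; rewrite -h /= ltnNge kn.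
have vbn : (VBranch n == VBranch b) = false.
  by apply/negP => /eqP [] h; rewrite h eqxx in bn.
elim: t G => [i|c s IHs s' _] G e ut; first by case/extends_node_inv: e => [[?[?[]]]|[?[?[?[]]]]].
have [_ _ us us' _] := uniq_verts_node ut; cbv zeta; rewrite mean_graft_node //.
case/extends_node_inv: e => [[_ [_ [[-> <- <-] es es']]]|
                              [_ [_ [_ [[<- <- <-] es fc fs']]]]].
  rewrite /= !eqxx bn vbn addn1.
  rewrite (@eq_mean_graft n s _ (fun x => G (nleaves s + nleaves s').+1 1%N x s')) //; last first.
    by move=> v vs; rewrite nleaves_graft.
  rewrite (@eq_mean_graft n s' _ (fun x => G (nleaves s + nleaves s').+1 1%N s x)) //; last first.
    by move=> v vs; rewrite nleaves_graft // addnS.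
  have := weight_sum ut; rewrite /= => <-; ring.
have [w w'] := weight_hang es nt0 fs'; rewrite w w'.
have cb : (c == b) = false.
  by apply/negP => /eqP h; move: fc; rewrite h /fresh nb.
have vcb : (VBranch c == VBranch b) = false.
  by apply/negP => /eqP [] h; rewrite h eqxx in cb.
rewrite /= cb vcb bn vbn addn1.
rewrite (IHs (fun N d => G (N + nleaves s')%N d.+1)) //.
rewrite (@mean_graft_nleaves n s' (fun N => G (nleaves s + N)%N (spine_length (VBranch b) s).+1
  (left_at b s) (right_at b s))) //.
rewrite addnS addSn natrD -natr1; ring.
Qed.
End MeanGraft.
(** * Graph distances along a spine *)

Lemma verts_neq_root t : VRoot \notin verts t.
Proof.
by elim: t => [j|b s IHs s' IHs'] //=; rewrite inE mem_cat !negb_or IHs IHs'.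
Qed.

Lemma edges_from_verts a t e : e \in edges_from a t ->
  (e.1 \in a :: verts t) /\ (e.2 \in verts t).
Proof.
elim: t a => [j|b s IHs s' IHs'] a /=; first by rewrite !inE => /eqP -> /=; rewrite !eqxx.
rewrite in_cons mem_cat => /or3P[/eqP ->|/IHs[]|/IHs'[]] /=.
- by rewrite !inE !eqxx.
- by rewrite !inE !mem_cat => /orP[] -> ->; rewrite ?orbT.
- by rewrite !inE !mem_cat => /orP[] -> ->; rewrite ?orbT.
Qed.

(** A height that increases by one along each edge changes by one at each step of
any path; it bounds graph distances from below. *)
Lemma height_exists a t (m : nat) : uniq (a :: verts t) ->
  exists2 h : vertex -> nat, h a = m &
    forall e, e \in edges_from a t -> h e.2 = (h e.1).+1.
Proof.
elim: t a m => [j|b s IHs s' IHs'] a m; rewrite cons_uniq => /andP[ant ut].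
  exists (fun v => if v == a then m else m.+1); first by rewrite eqxx.
  move=> e; rewrite /= !inE => /eqP -> /=; rewrite eqxx.
  by move: ant; rewrite /= inE eq_sym => /negbTE ->.
have [bs bs' us us' ss'] := uniq_verts_node ut.
have [|h hb hs] := IHs (VBranch b) m.+1; first by rewrite cons_uniq bs.
have [|h' hb' hs'] := IHs' (VBranch b) m.+1; first by rewrite cons_uniq bs'.
move: ant; rewrite /= inE mem_cat !negb_or => /and3P[ab as_ as'].
pose H v := if v == a then m else if v == VBranch b then m.+1
            else if v \in verts s then h v else h' v.
have Hs v : v \in VBranch b :: verts s -> H v = h v.
  rewrite /H inE; have [->|_] := eqVneq v a.
    by rewrite (negbTE ab) (negbTE as_).
  by have [-> //|_ /= ->] := eqVneq v (VBranch b).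
have Hs' v : v \in VBranch b :: verts s' -> H v = h' v.
  rewrite /H inE; have [->|_] := eqVneq v a.
    by rewrite (negbTE ab) (negbTE as').
  have [-> //|_ /= vs'] := eqVneq v (VBranch b); case: ifP => // vs.
  by exfalso; move/hasP: ss'; apply; exists v.
exists H; first by rewrite /H eqxx.
move=> e; rewrite in_cons mem_cat => /or3P[/eqP ->|es|es'] /=.
- by rewrite /H !eqxx eq_sym (negbTE ab).
- have [e1 e2] := edges_from_verts es.
  by rewrite !Hs ?hs // inE e2 orbT.
- have [e1 e2] := edges_from_verts es'.
  by rewrite !Hs' ?hs' // inE e2 orbT.
Qed.

(** The spine bounds the graph distance from above. *)
Lemma spine_path k t0 t a : extends k t0 t -> all (named_by k) (verts t0) ->
  exists p, [/\ path (fun u v => (u, v) \in edges_from a t) a p,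
                last a p = top t0 & size p = spine_length (top t0) t].
Proof.
move=> + nt0.
have one a' s : exists p, [/\ path (fun u v => (u, v) \in edges_from a' s) a' p,
    last a' p = top s & size p = 1%N].
  exists [:: top s]; split=> //=.
  by case: s => *; rewrite /= inE eqxx.
elim: t a => [j|b s IHs s' IHs'] a e.
  by have -> : t0 = TLeaf j by inversion e.
have [bt|bt] := eqVneq (VBranch b) (top t0).
  by rewrite -bt /= eqxx; have := one a (TNode b s s').
rewrite /= (negbTE bt).
have es : extends k t0 s.
  by inversion e; subst => //; move: bt; rewrite /= eqxx.
have [p [pp lp sp]] := IHs (VBranch b) es.
exists (VBranch b :: p); split; rewrite /= ?sp //.
rewrite inE eqxx /=; apply: sub_path pp => u v uv.
by rewrite inE mem_cat uv !orbT.
Qed.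

Lemma spine_length_le v t : (spine_length v t <= size (verts t))%N.
Proof.
elim: t => [//|b s IHs s' _] /=; case: ifP => _ //.
by rewrite size_cat ltnS (leq_trans IHs) // leq_addr.
Qed.

Lemma graph_dist_spine k t0 s a t : uniq (verts t) -> uniq (verts s) ->
  {subset edges_from a s <= edges t} -> extends k t0 s ->
  all (named_by k) (verts t0) ->
  graph_dist t a (top t0) = spine_length (top t0) s.
Proof.
move=> ut us sub es nt0.
have [p [pp lp sp]] := spine_path a es nt0.
have [|h _ ht] := @height_exists VRoot t 0; first by rewrite cons_uniq verts_neq_root.
have hup q u : path (fun u v => (u, v) \in edges_from a s) u q ->
    h (last u q) = (h u + size q)%N.
  elim: q u => [|v q IHq] u /=; first by rewrite addn0.
  by case/andP => /sub /ht /= huv /IHq ->; rewrite huv addSnnS.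
have hle q u : path (Defs.adjacent t) u q -> (h (last u q) <= h u + size q)%N.
  elim: q u => [|v q IHq] u /=; first by rewrite addn0.
  case/andP => uv /IHq /leq_trans; apply; rewrite -addSnnS leq_add2r.
  by case/orP: uv => /ht /= ->; rewrite ?leqnSn // (leq_trans (leqnSn _)).
have hD := hup _ _ pp; rewrite lp sp in hD.
rewrite /graph_dist; set Q := fun m => _; set D := spine_length _ _.
have QD : Q D.
  apply/asboolP; exists p; split => //.
  by apply: sub_path pp => u v /sub uv; rewrite /Defs.adjacent uv.
have Qmin m : Q m -> (D <= m)%N.
  move=> /asboolP[q [qq lq sq]]; have := hle _ _ qq.
  by rewrite lq sq hD leq_add2l.
have Dle : (D < (size (edges t)).+1)%N.
  have -> : size (edges t) = size (verts t) by rewrite -(verts_edges VRoot t) size_map.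
  rewrite ltnS (leq_trans (spine_length_le _ _)) //; apply: uniq_leq_size => // v.
  rewrite -(verts_edges a s) => /mapP[e /sub ee ->].
  by have [] := edges_from_verts ee.
have hasQ : has Q (iota 0 (size (edges t)).+1).
  by apply/hasP; exists D => //; rewrite mem_iota.
apply/eqP; rewrite eqn_leq; apply/andP; split.
  rewrite leqNgt; apply/negP => /(before_find 0%N).
  by rewrite nth_iota // add0n QD.
apply: Qmin; have := nth_find 0%N hasQ; rewrite nth_iota //.
by move: hasQ; rewrite has_find size_iota.
Qed.

(** * Subtrees planted at the vertices of the initial tree *)

(** [planted t0 a s f]: s is a subtree of t0 planted at the vertex a, and f finds the
corresponding subtree in any tree that extends t0. *)
Inductive planted (t0 : tree) : vertex -> tree -> (tree -> tree) -> Prop :=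
| PlantedRoot : planted t0 VRoot t0 id
| PlantedLeft a b s s' f : planted t0 a (TNode b s s') f ->
    planted t0 (VBranch b) s (fun t => left_at b (f t))
| PlantedRight a b s s' f : planted t0 a (TNode b s s') f ->
    planted t0 (VBranch b) s' (fun t => right_at b (f t)).

Lemma planted_edges_from t0 a s f e : planted t0 a s f -> e \in edges_from a s ->
  exists s1 f1, planted t0 e.1 s1 f1 /\ top s1 = e.2.
Proof.
elim: s a f => [j|b s IHs s' IHs'] a f pf /=.
  by rewrite inE => /eqP -> /=; exists (TLeaf j), f.
rewrite in_cons mem_cat => /or3P[/eqP ->||] /=.
- by exists (TNode b s s'), f.
- exact: IHs (PlantedLeft pf).
- exact: IHs' (PlantedRight pf).
Qed.

Lemma edges_at k b s0 s0' t a e : named_by k (VBranch b) ->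
  extends k (TNode b s0 s0') t ->
  e \in edges_from (VBranch b) (left_at b t) ++ edges_from (VBranch b) (right_at b t) ->
  e \in edges_from a t.
Proof.
move=> nb; elim: t a => [j|c s IHs s' _] a /extends_node_inv[].
- by case=> s [s' []].
- by case=> c [s [s' []]].
- case=> _ [_ [[-> <- <-]]] _ _ /=; rewrite eqxx in_cons => ->.
  by rewrite orbT.
- case=> _ [_ [_ [[<- <- <-]]]] e0 fc _; rewrite /=.
  case: eqP fc => [->|_ _]; first by rewrite /fresh nb.
  by move=> /(IHs (VBranch c) e0) es; rewrite in_cons mem_cat es !orbT.
Qed.

Section Planted.
Variables (R : realType) (alpha theta : R).
Hypotheses (alpha1 : alpha < 1) (theta0 : 0 <= theta).
Variables (k : nat) (t0 : tree).
Hypothesis nt0 : all (named_by k) (verts t0).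
Implicit Types (t s : tree) (f : tree -> tree).

Lemma planted_named a s f : planted t0 a s f -> all (named_by k) (verts s).
Proof. by elim=> // {a s f} a b s s' f _; rewrite /= all_cat => /and3P[]. Qed.

Lemma planted_extends a s f t : planted t0 a s f -> extends k t0 t ->
  uniq (verts t) ->
  [/\ extends k s (f t), uniq (verts (f t)) & {subset edges_from a (f t) <= edges t}].
Proof.
move=> pf et ut; elim: pf => {a s f} [|a b s s' f pf [ef uf sf]|a b s s' f pf [ef uf sf]].
- by split.
- have nb : named_by k (VBranch b) by have := planted_named pf => /= /andP[].
  have [e1 e2] := extends_at nb ef; split => //; first exact: uniq_left_at.
  by move=> e ee; apply/sf/(edges_at _ nb ef); rewrite mem_cat ee.
- have nb : named_by k (VBranch b) by have := planted_named pf => /= /andP[].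
  have [e1 e2] := extends_at nb ef; split => //; first exact: uniq_right_at.
  by move=> e ee; apply/sf/(edges_at _ nb ef); rewrite mem_cat ee orbT.
Qed.

Lemma weight_ge0 s s' : 0 <= weight alpha theta s s'.
Proof.
have h : 1 <= (nleaves s)%:R :> R by rewrite ler1n nleaves_gt0.
rewrite /weight /subtree_weight; case: ifP => _; move: theta0 alpha1; lra.
Qed.

(** A growth step either leaves the planted subtree alone or, with probability q, is a
growth step of that subtree under the same rule.  Hence it suffices to study a
functional of a planted subtree as if this subtree were the whole tree. *)
Lemma planted_mean_graft a s f n t : planted t0 a s f -> extends k t0 t ->
  uniq (verts t) -> (k <= n)%N ->
  exists2 q, 0 <= q & forall phi,
    mean_graft alpha theta n t (fun x => phi (f x)) =
    q * mean_graft alpha theta n (f t) phi + (1 - q) * phi (f t).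
Proof.
move=> pf et ut kn; elim: pf => {a s f} [|a b s s' f pf [q q0 qE]|a b s s' f pf [q q0 qE]].
- by exists 1 => // phi; rewrite mul1r subrr mul0r addr0.
- have [ef uf _] := planted_extends pf et ut.
  have D0 : 0 < (nleaves (f t))%:R - 1 + theta.
    by inversion ef; apply: node_denominator_gt0.
  exists (q * (weight alpha theta (left_at b (f t)) (right_at b (f t)) /
               ((nleaves (f t))%:R - 1 + theta))).
    by rewrite mulr_ge0 // divr_ge0 ?weight_ge0 // ltW.
  move=> phi; rewrite (qE (fun x => phi (left_at b x))).
  have := @mean_graft_spine_branch R alpha theta theta0 k b s s' (f t) n
    (fun _ _ l _ => phi l) ef (planted_named pf) uf kn.
  rewrite /= (mean_graft_cst alpha theta0 n (phi (left_at b (f t)))) ?uniq_right_at // => h.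
  move: h D0; move: (mean_graft _ _ _ (f t) _) => E.
  set D := _ - 1 + theta; set W := weight _ _ _ (right_at _ _).
  move=> h D0; have D1 : D != 0 by rewrite gt_eqF.
  have -> : E = D^-1 * (D * E) by rewrite mulKf.
  by rewrite h; field.
- have [ef uf _] := planted_extends pf et ut.
  have D0 : 0 < (nleaves (f t))%:R - 1 + theta.
    by inversion ef; apply: node_denominator_gt0.
  exists (q * (weight alpha theta (right_at b (f t)) (left_at b (f t)) /
               ((nleaves (f t))%:R - 1 + theta))).
    by rewrite mulr_ge0 // divr_ge0 ?weight_ge0 // ltW.
  move=> phi; rewrite (qE (fun x => phi (right_at b x))).
  have := @mean_graft_spine_branch R alpha theta theta0 k b s s' (f t) n
    (fun _ _ _ r => phi r) ef (planted_named pf) uf kn.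
  rewrite /= (mean_graft_cst alpha theta0 n (phi (right_at b (f t)))) ?uniq_left_at // => h.
  move: h D0; move: (mean_graft _ _ _ (f t) _) => E.
  set D := _ - 1 + theta; set W := weight _ _ (right_at _ _) _.
  move=> h D0; have D1 : D != 0 by rewrite gt_eqF.
  have -> : E = D^-1 * (D * E) by rewrite mulKf.
  by rewrite h; field.
Qed.

End Planted.
(** * A martingale and a supermartingale on planted trees *)

Section Potential.
Variables (R : realType) (alpha theta : R).
Hypotheses (alpha0 : 0 < alpha) (alpha1 : alpha < 1) (theta0 : 0 <= theta).

(** Bernoulli's inequality (1 - u) ^ alpha <= 1 - alpha u at u = 1 / (y + 1), obtained
from Young's inequality with exponents 1 / alpha and 1 / (1 - alpha). *)
Lemma powR_succ_le (y : R) : 0 < y ->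
  (y + 1) * y `^ alpha <= (y + 1 - alpha) * (y + 1) `^ alpha.
Proof.
move=> y0; have y1 : 0 < y + 1 by lra.
have beta0 : 0 < 1 - alpha by rewrite subr_gt0.
have z0 : 0 <= y / (y + 1) by rewrite divr_ge0 // ltW.
have /= := @conjugate_powR R ((y / (y + 1)) `^ alpha) 1 alpha^-1 (1 - alpha)^-1
  (powR_ge0 _ _) ler01.
rewrite !invr_gt0 !invrK mulr1 -powRrM mulfV ?gt_eqF // powRr1 // powR1 mul1r.
move=> /(_ alpha0 beta0); rewrite subrKC => /(_ erefl) h.
have e : y `^ alpha = (y / (y + 1)) `^ alpha * (y + 1) `^ alpha.
  by rewrite -powRM ?(ltW y1) // divfK ?gt_eqF.
rewrite e mulrA ler_wpM2r ?powR_ge0 //.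
have -> : y + 1 - alpha = (y + 1) * (y / (y + 1) * alpha + (1 - alpha)).
  by field; rewrite gt_eqF.
by rewrite ler_wpM2l // ltW.
Qed.

Definition potential (c : R) (N d : nat) : R :=
  (alpha * d%:R + c) / (N%:R - 2 + theta + alpha) `^ alpha.

(** With y = N - 2 + theta + alpha and A = alpha d + c, the left side is
A (y + 1) / (y + 1) ^ alpha and the right side is A (y + 1 - alpha) / y ^ alpha, so [powR_succ_le] applies. *)
Lemma potential_step c N d : (2 <= N)%N -> 0 <= alpha * d%:R + c ->
  (alpha * d%:R + c) * potential c N.+1 d.+1
  + (N%:R - 1 + theta - (alpha * d%:R + c)) * potential c N.+1 d
  <= (N%:R - 1 + theta) * potential c N d.
Proof.
move=> N2; rewrite /potential -[N.+1%:R]natr1 -[d.+1%:R]natr1 => A0.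
have hN : 2 <= N%:R :> R by rewrite ler_nat.
set y := N%:R - 2 + theta + alpha.
have y0 : 0 < y by rewrite /y; move: alpha0 theta0; lra.
have y10 : 0 < y + 1 by lra.
have -> : N%:R + 1 - 2 + theta + alpha = y + 1 by rewrite /y; ring.
have -> : N%:R - 1 + theta = y + 1 - alpha by rewrite /y; ring.
have := powR_succ_le y0.
have : 0 < y `^ alpha by rewrite powR_gt0.
have : 0 < (y + 1) `^ alpha by rewrite powR_gt0.
move: (y `^ alpha) ((y + 1) `^ alpha) => p0 p1 p1_gt0 p0_gt0 h.
set A := alpha * d%:R + c in A0 *.
have -> : A * ((alpha * (d%:R + 1) + c) / p1) + (y + 1 - alpha - A) * (A / p1)
  = A * ((y + 1) / p1) by rewrite /A; field; rewrite gt_eqF.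
by rewrite [leRHS]mulrCA ler_wpM2l // ler_pdivrMr // mulrAC ler_pdivlMr.
Qed.

Definition spine_const (v : vertex) : R := if v is VLeaf _ then theta - alpha else 0.

(** The maxima matter only while the subtree of a leaf edge is a single leaf, where
N - 2 + theta + alpha may fail to be positive.  The next step then leads to two leaves and a spine
of length 2 with certainty, and the value is that of this next state. *)
Definition spine_potential (v : vertex) (t : tree) : R :=
  potential (spine_const v) (maxn (nleaves t) 2)
    (maxn (spine_length v t) (if v is VLeaf _ then 2 else 1)).

Lemma spine_length_gt0 v t : (0 < spine_length v t)%N.
Proof. by case: t => //= b s _; case: ifP. Qed.

Lemma potential_base_ge0 (v : vertex) (d : nat) :
  (0 < d)%N -> 0 <= alpha * d%:R + spine_const v.
Proof.
move=> h; have := mulr_ge0 (ltW alpha0) (ler0n R d).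
case: v => [|j|b] /=; rewrite /spine_const ?addr0 // => _.
have d1 : 1 <= d%:R :> R by rewrite ler1n.
have := ler_wpM2l (ltW alpha0) d1; move: theta0; lra.
Qed.

Lemma spine_potential_ge0 v t : 0 <= spine_potential v t.
Proof.
rewrite /spine_potential /potential divr_ge0 ?powR_ge0 //.
by apply: potential_base_ge0; rewrite leq_max spine_length_gt0.
Qed.

Lemma mean_graft_spine_potential k t0 t n : extends k t0 t ->
  all (named_by k) (verts t0) -> uniq (verts t) -> (k <= n)%N ->
  mean_graft alpha theta n t (spine_potential (top t0)) <= spine_potential (top t0) t.
Proof.
case: t0 => [j|b s0 s0'] et nt0 ut kn; rewrite /spine_potential [top _]/=.
  have nj : named_by k (VLeaf j) by move: nt0; rewrite /= andbT.
  have := @mean_graft_spine_leaf R alpha theta theta0 k j t n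
    (fun N d => potential (theta - alpha) (maxn N 2) (maxn d 2)) et nj ut.
  rewrite /spine_const.
  case: (extends_leaf_inv et) => [-> _|[b [s [s' [te _ _ _]]]]]; first by rewrite /= lexx.
  have N2 : (2 <= nleaves t)%N.
    by rewrite te /=; have := nleaves_gt0 s; have := nleaves_gt0 s'; lia.
  have d2 : (2 <= spine_length (VLeaf j) t)%N.
    by rewrite te /= ltnS spine_length_gt0.
  have D0 : 0 < (nleaves t)%:R - 1 + theta by rewrite te node_denominator_gt0.
  rewrite !(maxn_idPl _) //; try by rewrite ltnW.
  have := @potential_step (theta - alpha) _ (spine_length (VLeaf j) t) N2.
  have A0 := @potential_base_ge0 (VLeaf j) (spine_length (VLeaf j) t) (ltnW d2).
  move=> /(_ A0); set A := _ + (theta - alpha).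
  set p1 := potential _ _ _; set p2 := potential _ _ _; set p3 := potential _ _ _.
  move=> h1 h2; rewrite -(ler_pM2l D0) h2; apply: le_trans h1.
  by rewrite le_eqVlt; apply/orP; left; apply/eqP; rewrite /A; ring.
have := @mean_graft_spine_branch R alpha theta theta0 k b s0 s0' t n
  (fun N d _ _ => potential 0 (maxn N 2) (maxn d 1)) et nt0 ut kn.
rewrite /spine_const /= !mean_graft_cst ?uniq_left_at ?uniq_right_at //.
have [D0 N2] : 0 < (nleaves t)%:R - 1 + theta /\ (2 <= nleaves t)%N.
  case/extends_node_inv: et => [[s [s' [-> _ _]]]|[c [s [s' [-> _ _ _]]]]];
  (split; first exact: node_denominator_gt0);
  by rewrite /=; have := nleaves_gt0 s; have := nleaves_gt0 s'; lia.
have d0 := spine_length_gt0 (VBranch b) t.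
rewrite !(maxn_idPl _) //; try by rewrite ltnW.
have := @potential_step 0 _ (spine_length (VBranch b) t) N2.
have A0 := @potential_base_ge0 (VBranch b) (spine_length (VBranch b) t) d0.
move=> /(_ A0); rewrite addr0.
set p1 := potential _ _ _; set p2 := potential _ _ _; set p3 := potential _ _ _.
move=> h1 h2; rewrite -(ler_pM2l D0) h2; apply: le_trans h1.
by rewrite le_eqVlt; apply/orP; left; apply/eqP; ring.
Qed.

Definition weight_const (s s' : tree) : R :=
  if (min_label s < min_label s')%N then theta - 1 else - alpha.

Lemma weight_constE s s' : weight alpha theta s s' = (nleaves s)%:R + weight_const s s'.
Proof. by rewrite /weight /subtree_weight /weight_const; case: ifP => _ //; ring. Qed.

Definition fraction (f : tree -> tree) (c : R) (t : tree) : R :=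
  ((nleaves (f t))%:R + c) / ((nleaves t)%:R - 1 + theta).

Lemma mean_graft_fraction k b s0 s0' t n : extends k (TNode b s0 s0') t ->
  all (named_by k) (verts (TNode b s0 s0')) -> uniq (verts t) -> (k <= n)%N ->
  mean_graft alpha theta n t (fraction (left_at b) (weight_const s0 s0')) =
    fraction (left_at b) (weight_const s0 s0') t /\
  mean_graft alpha theta n t (fraction (right_at b) (weight_const s0' s0)) =
    fraction (right_at b) (weight_const s0' s0) t.
Proof.
move=> et nt0 ut kn.
have nb : named_by k (VBranch b) by move: nt0 => /= /andP[].
have [el er] := extends_at nb et.
have [nl nr] : all (named_by k) (verts s0) /\ all (named_by k) (verts s0').
  by move: nt0; rewrite /= all_cat => /and3P[_ -> ->].
have D0 : 0 < (nleaves t)%:R - 1 + theta.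
  by case/extends_node_inv: et => [[s [s' [-> _ _]]]|[d [s [s' [-> _ _ _]]]]];
    exact: node_denominator_gt0.
have wc : weight alpha theta (left_at b t) (right_at b t) =
    (nleaves (left_at b t))%:R + weight_const s0 s0'.
  rewrite weight_constE; congr (_ + _); rewrite /weight_const.
  by rewrite (extends_min_label el nl) (extends_min_label er nr).
have wc' : weight alpha theta (right_at b t) (left_at b t) =
    (nleaves (right_at b t))%:R + weight_const s0' s0.
  rewrite weight_constE; congr (_ + _); rewrite /weight_const.
  by rewrite (extends_min_label el nl) (extends_min_label er nr).
have D1 : 0 < (nleaves t)%:R + 1 - 1 + theta by move: D0; lra.
split.
- set c := weight_const _ _ in wc *.
  have := @mean_graft_spine_branch R alpha theta theta0 k b s0 s0' t n
    (fun N d l _ => ((nleaves l)%:R + c) / (N%:R - 1 + theta)) et nt0 ut kn.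
  rewrite /= mean_graft_cst ?uniq_right_at //.
  rewrite (@mean_graft_nleaves R alpha theta theta0 n (left_at b t)
    (fun m => (m%:R + c) / ((nleaves t).+1%:R - 1 + theta))) ?uniq_left_at //.
  rewrite wc -!natr1 => h; apply: (mulfI (lt0r_neq0 D0)); rewrite /fraction h.
  by field; rewrite !gt_eqF.
- set c := weight_const _ _ in wc' *.
  have := @mean_graft_spine_branch R alpha theta theta0 k b s0 s0' t n
    (fun N d _ r => ((nleaves r)%:R + c) / (N%:R - 1 + theta)) et nt0 ut kn.
  rewrite /= mean_graft_cst ?uniq_left_at //.
  rewrite (@mean_graft_nleaves R alpha theta theta0 n (right_at b t)
    (fun m => (m%:R + c) / ((nleaves t).+1%:R - 1 + theta))) ?uniq_right_at //.
  rewrite wc' -!natr1 => h; apply: (mulfI (lt0r_neq0 D0)); rewrite /fraction h.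
  by field; rewrite !gt_eqF.
Qed.
End Potential.
(** * Almost sure convergence of nonnegative supermartingales *)

Section LiminfBound.
Context (d : measure_display) (R : realType) (Omega : measurableType d).
Variable P : probability Omega R.

(** Fatou's lemma: the lower limit has finite mean, hence is finite almost surely. *)
Lemma ae_frequently_bounded (f : nat -> Omega -> R) (C : R) :
  (forall n, measurable_fun setT (f n)) -> (forall n w, 0 <= f n w) ->
  (forall n, (\int[P]_w (f n w)%:E <= C%:E)%E) ->
  {ae P, forall w, exists M : R, forall N, exists2 n, (N <= n)%N & f n w <= M}.
Proof.
move=> mf f0 fC.
have mE n : measurable_fun setT (EFin \o f n) by exact/measurable_EFinP.
pose g w := limn_einf (fun n => (f n w)%:E).
have mg : measurable_fun setT g.
  rewrite /g /limn_einf; apply: measurableT_comp => //.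
  apply: (@measurable_fun_limn_esup _ _ _ setT (fun n w => (- (f n w)%:E)%E)) => n.
  by have := measurableT_comp (@oppe_measurable R setT) (mE n).
have g_ge w M : (\forall n \near \oo, M <= f n w) -> (M%:E <= g w)%E.
  move=> [N _ hN]; rewrite /g limn_einf_lim.
  apply: lime_ge; first exact: is_cvg_einfs.
  exists N => // m /= Nm; apply: le_ereal_inf_tmp => _ [k /= mk <-].
  by rewrite lee_fin; apply: hN => /=; rewrite (leq_trans Nm).
have g0 w : (0 <= g w)%E by apply: (g_ge w 0); exists 0%N => // n _.
have gC : (\int[P]_w g w <= C%:E)%E.
  apply: le_trans (fatou _ _ mE _) _ => //; first by move=> n w _; rewrite lee_fin.
  rewrite limn_einf_lim; apply: lime_le; first exact: is_cvg_einfs.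
  exists 0%N => // m _; apply: le_trans (fC m).
  by apply: ereal_inf_lbound; exists m => /=.
have ig : P.-integrable setT g.
  apply/integrableP; split => //.
  rewrite (eq_integral g) => [|w _]; last by rewrite gee0_abs.
  by rewrite (le_lt_trans gC) // ltry.
apply: filterS (integrable_ae measurableT ig) => w /(_ I) gfin.
exists (fine (g w) + 1) => N; apply: contrapT => h.
have /g_ge : \forall n \near \oo, fine (g w) + 1 <= f n w.
  exists N => // n /= Nn; rewrite leNgt; apply/negP => fn; apply: h; exists n => //.
  exact: ltW.
rewrite -[leRHS](fineK gfin) lee_fin; lra.
Qed.
End LiminfBound.

(** The limit is the supremum of the levels above which the sequence eventually stays;
it is exceeded infinitely often by a fixed margin only if some rational interval
is crossed infinitely often. *)
Lemma cvg_no_upcrossing (R : realType) (x : nat -> R) (M : R) :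
  (forall n, 0 <= x n) -> (forall N, exists2 n, (N <= n)%N & x n <= M) ->
  (forall a b : rat, 0 < (ratr a : R) < ratr b ->
     ~ ((forall N, exists2 n, (N <= n)%N & x n <= ratr a) /\
        (forall N, exists2 n, (N <= n)%N & ratr b <= x n))) ->
  cvgn x.
Proof.
move=> x0 xM nocross.
have up (u v : R) : 0 <= u -> u < v -> (forall N, exists2 n, (N <= n)%N & x n <= u) ->
    \forall n \near \oo, x n < v.
  move=> u0 uv hu.
  have [a] := rat_in_itvoo uv; rewrite in_itv /= => /andP[ua av].
  have [b] := rat_in_itvoo av; rewrite in_itv /= => /andP[ab bv].
  apply: contrapT => h; apply: (nocross a b).
    by rewrite ab (le_lt_trans u0 ua).
  split=> N.
    by have [n Nn xn] := hu N; exists n => //; rewrite (le_trans xn) // ltW.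
  apply: contrapT => h'; apply: h; exists N => // n /= Nn; rewrite ltNge; apply/negP => vx.
  by apply: h'; exists n => //; rewrite (le_trans _ vx) // ltW.
have M0 : 0 <= M by have [n _ xn] := xM 0%N; exact: le_trans (x0 n) xn.
have [N1 _ hN1] := up M (M + 1) M0 ltac:(lra) xM.
pose A := [set y : R | 0 <= y /\ \forall n \near \oo, y <= x n].
have hsA : has_sup A.
  split; first by exists 0; split => //; exists 0%N => // n _.
  exists (M + 1) => y [_ [N _ hN]].
  apply: ltW; apply: le_lt_trans (hN (maxn N N1) _) (hN1 (maxn N N1) _);
    by rewrite /= leq_max leqnn ?orbT.
apply/cvg_ex; exists (sup A); apply/cvgrPdist_lt => e e0.
have l0 : 0 <= sup A.
  by apply: ub_le_sup; [exact: hsA.2|split => //; exists 0%N => // n _].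
have [y [y0 hy] ly] := sup_adherent e0 hsA.
have : \forall n \near \oo, x n < sup A + e.
  apply: (up (sup A + e / 2)); [lra|lra|] => N.
  apply: contrapT => h.
  have : A (sup A + e / 2).
    split; first by lra.
    exists N => // n /= Nn; rewrite leNgt; apply/negP => xn; apply: h; exists n => //.
    exact: ltW.
  by move/(ub_le_sup hsA.2); lra.
move: hy; apply: filterS2 => n h1 h2; rewrite ltr_norml; apply/andP; split; lra.
Qed.

Section Betting.
Variables (R : realType) (a b : R).
Hypotheses (a0 : 0 < a) (ab : a < b).

(** The state is (is a share held, number of sales so far, cash), updated when the
price x is observed. *)
Definition bet_step (x : R) (st : bool * nat * R) : bool * nat * R :=
  let: (h, u, c) := st in
  if h then (if b <= x then (false, u.+1, c + x) else st)
  else (if x <= a then (true, u, c - x) else st).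

Fixpoint bet (x : nat -> R) (n : nat) : bool * nat * R :=
  bet_step (x n) (if n is m.+1 then bet x m else (false, 0%N, a)).

Definition holds x n : bool := (bet x n).1.1.
Definition sales x n : nat := (bet x n).1.2.
Definition cash x n : R := (bet x n).2.

(** A purchase costs at most a and a sale brings at least b, so every completed round
adds at least b - a to the cash. *)
Lemma bet_inv x n : (forall n, 0 <= x n) ->
  (if holds x n then (b - a) * (sales x n)%:R else a + (b - a) * (sales x n)%:R)
  <= cash x n.
Proof.
move=> x0; rewrite /holds /sales /cash.
have step (y : R) st : 0 <= y ->
    (if st.1.1 then (b - a) * st.1.2%:R else a + (b - a) * st.1.2%:R) <= st.2 ->
    (if (bet_step y st).1.1 then (b - a) * (bet_step y st).1.2%:R
     else a + (b - a) * (bet_step y st).1.2%:R) <= (bet_step y st).2.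
  move=> y0; case: st => [[[] u] c] /=.
    have [by_ /= h|//] := leP b y.
    by rewrite -[u.+1%:R]natr1 mulrDr mulr1; lra.
  by have [ya /= h|//] := leP y a; lra.
by elim: n => [|n IHn]; apply: step => //=; rewrite ?mulr0 ?addr0.
Qed.

Lemma cash_ge0 x n : (forall n, 0 <= x n) -> 0 <= cash x n.
Proof.
move=> x0; apply: le_trans (bet_inv n x0).
have : 0 <= (b - a) * (sales x n)%:R by rewrite mulr_ge0 // subr_ge0 ltW.
by move: a0; case: ifP => _; lra.
Qed.

Definition wealth x n : R := cash x n + (holds x n)%:R * x n.

Lemma wealth_ge_sales x n : (forall n, 0 <= x n) ->
  (b - a) * (sales x n)%:R <= wealth x n.
Proof.
move=> x0; have := bet_inv n x0; have := x0 n; rewrite /wealth.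
by move: a0; case: (holds x n) => /=; rewrite ?mul1r ?mul0r; lra.
Qed.

Lemma bet_step_wealth y st :
  (bet_step y st).2 + ((bet_step y st).1.1)%:R * y = st.2 + (st.1.1)%:R * y.
Proof.
case: st => [[[] u] c] /=.
  by have [_|_] := leP b y; rewrite /= ?mul1r ?mul0r; ring.
by have [_|_] := leP y a; rewrite /= ?mul1r ?mul0r; ring.
Qed.

Lemma wealth0 x : wealth x 0 = a.
Proof. by rewrite /wealth /cash /holds bet_step_wealth /= mul0r addr0. Qed.

(** Trading at the current price does not change the wealth, so the wealth varies only
through the price of a share held beforehand. *)
Lemma wealthS x n : wealth x n.+1 = cash x n + (holds x n)%:R * x n.+1.
Proof. by rewrite /wealth /cash /holds /= bet_step_wealth. Qed.

Lemma holds_low x n : x n <= a -> holds x n.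
Proof.
move=> xa; rewrite /holds.
case: n xa => [|n] xa /=; first by rewrite xa.
case: (bet x n) => [[[] u] c] /=; last by rewrite xa.
by case: leP => // bx; move: (lt_le_trans ab bx); rewrite ltNge xa.
Qed.

Lemma not_holds_high x n : b <= x n -> holds x n = false.
Proof.
move=> bx; have ax : (x n <= a) = false by apply/negbTE; rewrite -ltNge (lt_le_trans ab).
rewrite /holds; case: n bx ax => [|n] bx ax /=; first by rewrite ax.
by case: (bet x n) => [[[] u] c] /=; rewrite ?bx ?ax.
Qed.

Lemma sales_step x n : (sales x n + (holds x n && ~~ holds x n.+1) <= sales x n.+1)%N.
Proof.
rewrite /sales /holds /=; case: (bet x n) => [[[] u] c] /=.
  by have [_|_] := leP b (x n.+1); rewrite /= ?addn0 ?addn1.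
by have [_|_] := leP (x n.+1) a; rewrite /= ?addn0 ?addn1.
Qed.

Lemma sales_homo x : {homo sales x : m n / (m <= n)%N}.
Proof.
apply: homo_leq => // [m n p|n]; first exact: leq_trans.
by apply: leq_trans (sales_step x n); rewrite leq_addr.
Qed.

Lemma sales_lt x m n : (m <= n)%N -> holds x m -> ~~ holds x n ->
  (sales x m < sales x n)%N.
Proof.
elim: n => [|n IHn]; first by rewrite leqn0 => /eqP -> ->.
rewrite leq_eqVlt => /orP[/eqP -> ->//|mn] hm hn.
have [hn'|hn'] := boolP (holds x n).
  have := sales_step x n; rewrite hn' hn addn1; apply: leq_trans.
  by rewrite ltnS; apply: sales_homo.
by apply: leq_trans (IHn mn hm hn') _; apply: sales_homo.
Qed.

Lemma sales_unbounded x :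
  (forall N, exists2 n, (N <= n)%N & x n <= a) ->
  (forall N, exists2 n, (N <= n)%N & b <= x n) ->
  forall K, exists N, (K <= sales x N)%N.
Proof.
move=> lo hi; elim=> [|K [N KN]]; first by exists 0%N.
have [m Nm xm] := lo N; have [n mn xn] := hi m.
exists n; apply: leq_ltn_trans (sales_lt mn (holds_low xm) _).
  by apply: leq_trans KN _; apply: sales_homo.
by rewrite not_holds_high.
Qed.

Lemma eq_bet x x' n : (forall i, (i <= n)%N -> x i = x' i) -> bet x n = bet x' n.
Proof.
elim: n => [|n IHn] h /=; first by rewrite h.
by rewrite h // IHn // => i /leqW; apply: h.
Qed.

End Betting.

Section Supermartingale.
Context (d : measure_display) (R : realType) (Omega : measurableType d).
Variables (P : probability Omega R) (S : countType) (F : nat -> Omega -> S).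
Hypothesis mF : forall n s, measurable [set w | F n w = s].

(** F n encodes the history up to time n: determined functions are those measurable
with respect to the sigma-algebra generated by the partition into level sets
of F n. *)
Definition determined (n : nat) (U : Type) (f : Omega -> U) : Prop :=
  forall w w', F n w = F n w' -> f w = f w'.

(** The level sets of F n, indexed by the natural numbers so that countable unions and
series apply; some are empty. *)
Definition cell (n i : nat) : set Omega := [set w | pickle (F n w) = i].

Lemma cell_cases n i : cell n i = set0 \/ exists s, cell n i = [set w | F n w = s].
Proof.
have [->|/set0P[w wi]] := eqVneq (cell n i) set0; [by left|right].
exists (F n w); apply/seteqP; split => w' /=.
  by move=> h; apply: (pcan_inj pickleK); rewrite h -wi.
by rewrite /cell /= => ->.
Qed.

Lemma measurable_cell n i : measurable (cell n i).
Proof. by case: (cell_cases n i) => [->|[s ->]]. Qed.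

Lemma determined_cell n (A : set Omega) i : determined n A ->
  A `&` cell n i = set0 \/ A `&` cell n i = cell n i.
Proof.
move=> dA; have [->|/set0P[w [Aw wi]]] := eqVneq (A `&` cell n i) set0; [by left|right].
apply/seteqP; split => w' /= => [[]//|w'i]; split => //.
have <- : A w = A w' by apply/dA/(pcan_inj pickleK); rewrite wi w'i.
by [].
Qed.

Lemma bigcup_cell n (A : set Omega) : A = \bigcup_i (A `&` cell n i).
Proof.
apply/seteqP; split => w /= => [Aw|[i _ []//]].
by exists (pickle (F n w)).
Qed.

Lemma determined_measurable n (A : set Omega) : determined n A -> measurable A.
Proof.
move=> dA; rewrite (bigcup_cell n A); apply: bigcupT_measurable => i.
by have [->|->] := determined_cell i dA; [exact: measurable0|exact: measurable_cell].
Qed.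

Lemma determined_measurable_fun n d' (U : measurableType d') (f : Omega -> U) :
  determined n f -> measurable_fun setT f.
Proof.
move=> df _ Y mY; rewrite setTI; apply: (@determined_measurable n) => w w' e.
by rewrite /preimage /= (df _ _ e).
Qed.

Lemma determinedW m n U (f : Omega -> U) :
  (forall n, determined n.+1 (F n)) -> (m <= n)%N -> determined m f -> determined n f.
Proof.
move=> FF mn df; elim: n mn => [|n IHn]; first by rewrite leqn0 => /eqP <-.
rewrite leq_eqVlt => /orP[/eqP <-//|mn] w w' e.
by apply: IHn => //; apply: FF.
Qed.

Hypothesis FF : forall n, determined n.+1 (F n).
Variable X : nat -> Omega -> R.
Hypothesis X0 : forall n w, 0 <= X n w.
Hypothesis XF : forall n, determined n (X n).
Hypothesis Xsuper : forall n s,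
  (\int[P]_(w in [set w | F n w = s]) (X n.+1 w)%:E
   <= \int[P]_(w in [set w | F n w = s]) (X n w)%:E)%E.

Lemma X_measurable n : measurable_fun setT (EFin \o X n).
Proof. exact/measurable_EFinP/(determined_measurable_fun (@XF n)). Qed.

Lemma integral_cells n m (A : set Omega) : determined n A ->
  (\int[P]_(w in A) (X m w)%:E =
   \sum_(i <oo) \int[P]_(w in A `&` cell n i) (X m w)%:E)%E.
Proof.
move=> dA; rewrite {1}(bigcup_cell n A) ge0_integral_bigcup //.
- by move=> i; apply: measurableI; [exact: determined_measurable dA|exact: measurable_cell].
- by apply: (measurable_funS measurableT) => //; exact: X_measurable.
- by move=> w _; rewrite lee_fin.
- by move=> i j _ _ [w [[_ <-] [_ <-]]].
Qed.

Lemma super_determined n (A : set Omega) : determined n A ->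
  (\int[P]_(w in A) (X n.+1 w)%:E <= \int[P]_(w in A) (X n w)%:E)%E.
Proof.
move=> dA; rewrite !(integral_cells _ dA); apply: lee_nneseries => [i _ _|i _].
  by apply: integral_ge0 => w _; rewrite lee_fin.
have [->|->] := determined_cell i dA; first by rewrite !integral_set0.
by case: (cell_cases n i) => [->|[s ->]]; rewrite ?integral_set0.
Qed.

Lemma super_mean n : (\int[P]_w (X n w)%:E <= \int[P]_w (X 0 w)%:E)%E.
Proof.
elim: n => [//|n IHn]; apply: le_trans IHn.
by apply: super_determined => w w' _.
Qed.

Section Bet.
Variables a b : R.
Hypotheses (a0 : 0 < a) (ab : a < b).

Lemma bet_determined n : determined n (fun w => bet a b (X^~ w) n).
Proof.
move=> w w' e; apply: eq_bet => i iN.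
exact: (determinedW FF iN (@XF i)).
Qed.

Lemma holds_determined n : determined n [set w | holds a b (X^~ w) n].
Proof. by move=> w w' e; rewrite /= /holds (bet_determined e). Qed.

Lemma cash_determined n : determined n (fun w => cash a b (X^~ w) n).
Proof. by move=> w w' e; rewrite /= /cash (bet_determined e). Qed.

Lemma integral_hold n m : (n <= m)%N ->
  (\int[P]_w (cash a b (X^~ w) n + (holds a b (X^~ w) n)%:R * X m w)%:E =
   \int[P]_w (cash a b (X^~ w) n)%:E +
   \int[P]_(w in [set w | holds a b (X^~ w) n]) (X m w)%:E)%E.
Proof.
move=> nm.
have mh : measurable [set w | holds a b (X^~ w) n].
  exact: determined_measurable (@holds_determined n).
have dX : determined m (fun w => (holds a b (X^~ w) n)%:R * X m w).
  move=> w w' e; rewrite (XF e); congr (_ * _).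
  have := determinedW FF nm (@bet_determined n) e.
  by rewrite /holds => ->.
under eq_integral do rewrite EFinD.
rewrite ge0_integralD //.
- congr (_ + _)%E; rewrite [RHS]integral_mkcond; apply: eq_integral => w _.
  rewrite patchE; case: ifPn; rewrite ?inE /= ?notin_setE /=.
    by move=> ->; rewrite mul1r.
  by move=> /negP/negbTE ->; rewrite mul0r.
- by move=> w _; rewrite lee_fin cash_ge0.
- exact/measurable_EFinP/(determined_measurable_fun (@cash_determined n)).
- by move=> w _; rewrite lee_fin mulr_ge0.
- exact/measurable_EFinP/(determined_measurable_fun dX).
Qed.

(** The decision to hold a share at time n depends on the past only, so betting on a
supermartingale gains nothing on average. *)
Lemma wealth_mean n : (\int[P]_w (wealth a b (X^~ w) n)%:E <= a%:E)%E.
Proof.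
elim: n => [|n IHn].
  under eq_integral do rewrite wealth0.
  by rewrite integral_cst //= probability_setT mule1.
apply: le_trans IHn.
under eq_integral do rewrite wealthS.
rewrite integral_hold // /wealth integral_hold // leeD2l //.
exact/super_determined/holds_determined.
Qed.

(** The mean number of sales is at most a / (b - a), while infinitely many upcrossings
force infinitely many sales. *)
Lemma ae_no_upcrossing : {ae P, forall w,
  ~ ((forall N, exists2 n, (N <= n)%N & X n w <= a) /\
     (forall N, exists2 n, (N <= n)%N & b <= X n w))}.
Proof.
pose f n w : R := (sales a b (X^~ w) n)%:R.
have mf n : measurable_fun setT (f n).
  apply: (@determined_measurable_fun n) => w w' e.
  by rewrite /f /sales (bet_determined e).
have bapos : 0 < b - a by rewrite subr_gt0.
have fC n : (\int[P]_w (f n w)%:E <= (a / (b - a))%:E)%E.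
  have : (\int[P]_w ((b - a) * f n w)%:E <= a%:E)%E.
    apply: le_trans (wealth_mean n); apply: ge0_le_integral => //.
    - by move=> w _; rewrite lee_fin mulr_ge0 // ltW.
    - by apply/measurable_EFinP; apply: measurable_funM => //; exact: measurable_cst.
    - apply/measurable_EFinP; apply: (@determined_measurable_fun n) => w w' e.
      by rewrite /wealth /holds /cash (bet_determined e) (XF e).
    - by move=> w _; rewrite lee_fin wealth_ge_sales.
  under eq_integral do rewrite EFinM.
  rewrite ge0_integralZl_EFin ?(ltW bapos) //; last 2 first.
  - by move=> w _; rewrite lee_fin.
  - exact/measurable_EFinP.
  by rewrite -lee_pdivlMl // -EFinM mulrC.
apply: filterS (ae_frequently_bounded mf _ fC); last by move=> n w; rewrite ler0n.
move=> w [M hM] [lo hi].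
have [N hN] := sales_unbounded ab lo hi (Num.truncn M).+1.
have [n Nn] := hM N; rewrite /f leNgt => /negP; apply.
have M0 : 0 <= M by have [m _] := hM 0%N; apply: le_trans; rewrite /f ler0n.
apply: lt_le_trans (truncnS_gt M) _; rewrite ler_nat.
by apply: leq_trans hN _; apply: sales_homo.
Qed.

End Bet.

Theorem supermartingale_cvg (C : R) : (\int[P]_w (X 0 w)%:E <= C%:E)%E ->
  {ae P, forall w, cvgn (X^~ w)}.
Proof.
move=> X0C.
have mX n : measurable_fun setT (X n) := determined_measurable_fun (@XF n).
have hM := ae_frequently_bounded mX X0 (fun n => le_trans (super_mean n) X0C).
have hU : {ae P, forall w, forall i : nat,
    match @unpickle (rat * rat)%type i with
    | Some (a, b) => 0 < (ratr a : R) < ratr b ->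
        ~ ((forall N, exists2 n, (N <= n)%N & X n w <= ratr a) /\
        (forall N, exists2 n, (N <= n)%N & ratr b <= X n w))
    | None => True
    end}.
  apply: ae_foralln => i; case: (unpickle i) => [[a b]|]; last exact: aeW.
  have [/andP[a0 ab]|_] := boolP (0 < (ratr a : R) < ratr b); last exact: aeW.
  by apply: filterS (ae_no_upcrossing a0 ab).
apply: filterS2 hM hU => w [M hM] hU.
apply: (cvg_no_upcrossing (X0^~ w) hM) => a b.
by have := hU (pickle (a, b)); rewrite pickleK.
Qed.

End Supermartingale.
(** * Functionals of the tree growth process *)

Fixpoint tree_encode (t : tree) : GenTree.tree nat :=
  match t with
  | TLeaf j => GenTree.Leaf j
  | TNode b s s' => GenTree.Node b [:: tree_encode s; tree_encode s']
  end.

Fixpoint tree_decode (x : GenTree.tree nat) : option tree :=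
  match x with
  | GenTree.Leaf j => Some (TLeaf j)
  | GenTree.Node b [:: x1; x2] =>
      if (tree_decode x1, tree_decode x2) is (Some s, Some s') then Some (TNode b s s')
      else None
  | _ => None
  end.

Lemma tree_encodeK : pcancel tree_encode tree_decode.
Proof. by elim=> //= b s -> s' ->. Qed.

HB.instance Definition _ := Countable.copy tree (pcan_type tree_encodeK).

Section DiscreteIntegral.
Context (d : measure_display) (R : realType) (Omega : measurableType d).
Variables (P : probability Omega R) (S : countType) (Y : Omega -> S).
Hypothesis mY : forall s, measurable [set w | Y w = s].

Lemma discrete_measurable_fun d' (U : measurableType d') (f : S -> U) :
  measurable_fun setT (f \o Y).
Proof.
apply: (@determined_measurable_fun d Omega S (fun _ => Y) _ 0%N); first by move=> _.
by move=> w w'; rewrite /= => ->.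
Qed.

Lemma discrete_measurable (A : set S) : measurable [set w | A (Y w)].
Proof.
apply: (@determined_measurable d Omega S (fun _ => Y) _ 0%N); first by move=> _.
by move=> w w'; rewrite /= => ->.
Qed.

Lemma integral_split (phi : S -> R) (C : set Omega) (l : seq S) :
  (forall s, 0 <= phi s) -> measurable C -> uniq l ->
  (\int[P]_(w in C) (phi (Y w))%:E =
   \sum_(s <- l) (phi s)%:E * P (C `&` [set w | Y w = s])
   + \int[P]_(w in C `&` [set w | Y w \notin l]) (phi (Y w))%:E)%E.
Proof.
move=> phi0 mC; elim: l => [_|s l IHl] /=.
  rewrite big_nil add0e; congr (integral _ _ _).
  by apply/seteqP; split => w //= [].
case/andP=> sl ul; rewrite IHl // big_cons.
have mphi D : measurable_fun D (fun w => (phi (Y w))%:E).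
  apply: (measurable_funS measurableT) => //.
  exact: (discrete_measurable_fun (EFin \o phi)).
have -> : C `&` [set w | Y w \notin l] = (C `&` [set w | Y w = s]) `|`
    (C `&` [set w | Y w \notin s :: l]).
  apply/seteqP; split => w /=.
    by case=> Cw Yl; have [e|ne] := eqVneq (Y w) s; [left|right]; rewrite // inE negb_or ne.
  by case=> -[Cw]; [move=> ->|rewrite inE negb_or => /andP[]].
rewrite ge0_integral_setU //; last 4 first.
- exact: measurableI.
- exact/measurableI/(discrete_measurable (fun y => y \notin s :: l)).
- by move=> w _; rewrite lee_fin.
- apply/disj_setPS => w /= [[_ ->] [_]].
  by rewrite inE eqxx.
have -> : (\int[P]_(w in C `&` [set w | Y w = s]) (phi (Y w))%:E =
    (phi s)%:E * P (C `&` [set w | Y w = s]))%E.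
  rewrite -integral_cst; last exact: measurableI.
  by apply: eq_integral => w; rewrite inE => -[_ /= ->].
by rewrite addeCA addeA.
Qed.

End DiscreteIntegral.

Section Growth.
Context (d : measure_display) (R : realType) (Omega : measurableType d).
Variables (P : probability Omega R) (alpha theta : R) (T : nat -> Omega -> tree).
Hypothesis theta0 : 0 <= theta.
Hypothesis hT : tree_growth_process P alpha theta T.

Definition hist (n : nat) (w : Omega) : seq tree := [seq T i w | i <- iota 1 n].

Lemma histP n w w' :
  hist n w = hist n w' <-> forall i, (1 <= i <= n)%N -> T i w = T i w'.
Proof.
split=> [/eq_in_map h i hi|h]; last apply/eq_in_map => i.
  by apply: h; rewrite mem_iota add1n ltnS.
by rewrite mem_iota add1n ltnS => /h.
Qed.

Lemma T_measurable n t : (1 <= n)%N -> measurable [set w | T n w = t].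
Proof. by case: hT => h _ _ _; apply: h. Qed.

Lemma hist_measurable n s : measurable [set w | hist n w = s].
Proof.
have [->|/set0P[w0 <-]] := eqVneq [set w | hist n w = s] set0; first exact: measurable0.
have -> : [set w | hist n w = hist n w0] =
    \bigcap_i (if (1 <= i <= n)%N then [set w | T i w = T i w0] else setT).
  apply/seteqP; split => w /=; rewrite histP => h i.
    by move=> _; case: ifP => // /h.
  by move=> hi; have := h i I; rewrite hi.
apply: bigcapT_measurable => i; case: ifP => // /andP[i1 _]; exact: T_measurable.
Qed.

Lemma histS n w w' : hist n.+1 w = hist n.+1 w' -> hist n w = hist n w'.
Proof.
by move/histP => h; apply/histP => i /andP[i1 iN]; apply: h; rewrite i1 ltnW.
Qed.

Lemma hist_T n i w w' : hist n w = hist n w' -> (1 <= i <= n)%N -> T i w = T i w'.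
Proof. by move/histP; apply. Qed.

(** The prescribed conditional law at time n >= 2, and at n = 1 the deterministic
transition from T_1 to T_2. *)
Lemma growth_law n w0 v : (1 <= n)%N -> v \in verts (T n w0) ->
  P ([set w | hist n w = hist n w0] `&` [set w | T n.+1 w = graft n v (T n w0)]) =
  (P [set w | hist n w = hist n w0] * (select_prob alpha theta (T n w0) v)%:E)%E.
Proof.
case: hT => _ T1 T2 law n1 vt.
have pastE : [set w | hist n w = hist n w0] =
    [set w | forall i, (1 <= i <= n)%N -> T i w = (T^~ w0) i].
  by apply/seteqP; split => w /= /histP.
move: n1; rewrite leq_eqVlt => /orP[/eqP e|n2].
  subst n; move: vt; rewrite T1 /= inE => /eqP ->; rewrite !eqxx mule1.
  rewrite (_ : [set w | T 2 w = _] = setT) ?setIT //.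
  by apply/seteqP; split => // w _ /=; rewrite T2.
have : v \in [seq e.2 | e <- edges (T n w0)] by rewrite verts_edges.
by case/mapP => e ee ->; rewrite pastE; apply: law.
Qed.

Lemma graft_uniq n t : grown n t -> uniq [seq graft n v t | v <- verts t].
Proof.
case/grown_wf => ut nt nb; rewrite map_inj_in_uniq // => v v' vt v't.
apply: graft_inj => //; apply/negP => /(allP nb) /=; by rewrite ltnn.
Qed.

Lemma step_sum n w0 phi : (1 <= n)%N -> grown n (T n w0) ->
  (\sum_(s <- [seq graft n v (T n w0) | v <- verts (T n w0)])
     (phi s)%:E * P ([set w | hist n w = hist n w0] `&` [set w | T n.+1 w = s]) =
  P [set w | hist n w = hist n w0] * (mean_graft alpha theta n (T n w0) phi)%:E)%E.
Proof.
move=> n1 /grown_wf[ut _ _]; rewrite big_map mean_graftE //.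
have law v := @growth_law n w0 v n1.
have Pfin := fin_num_measure P _ (hist_measurable n (hist n w0)).
move: law; rewrite -(fineK Pfin); move: (fine _) => p law.
rewrite -EFinM mulr_sumr -sumEFin !big_seq; apply: eq_bigr => v vt.
by rewrite law // -!EFinM; congr (_%:E); ring.
Qed.

(** Distinct edges give distinct trees and their probabilities sum to 1, so nothing is
left for the event that T_{n+1} is not a graft of T_n. *)
Lemma step_leak n w0 : (1 <= n)%N -> grown n (T n w0) ->
  P ([set w | hist n w = hist n w0] `&`
     [set w | T n.+1 w \notin [seq graft n v (T n w0) | v <- verts (T n w0)]]) = 0%E.
Proof.
move=> n1 gt; have mC := hist_measurable n (hist n w0).
have mT s := @T_measurable n.+1 s isT.
have := integral_split P mT (fun=> ler01) mC (graft_uniq gt).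
rewrite step_sum // mean_graft_cst //; last by have [] := grown_wf gt.
have mD : measurable ([set w | hist n w = hist n w0] `&`
     [set w | T n.+1 w \notin [seq graft n v (T n w0) | v <- verts (T n w0)]]).
  exact/measurableI/(discrete_measurable mT (fun y => y \notin _)).
rewrite !integral_cst // !mul1e mule1.
have zero (a b : \bar R) : a \is a fin_num -> a = (a + b)%E -> b = 0%E.
  move: a b => [a| |] [b| |] //= _ [] e; congr (_%:E); lra.
by apply: zero; apply: fin_num_measure.
Qed.

Lemma step_integral n w0 phi : (1 <= n)%N -> grown n (T n w0) ->
  (forall s, 0 <= phi s) ->
  (\int[P]_(w in [set w | hist n w = hist n w0]) (phi (T n.+1 w))%:E =
   P [set w | hist n w = hist n w0] * (mean_graft alpha theta n (T n w0) phi)%:E)%E.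
Proof.
move=> n1 gt phi0; have mC := hist_measurable n (hist n w0).
have mT s := @T_measurable n.+1 s isT.
rewrite (integral_split P mT phi0 mC (graft_uniq gt)) step_sum //.
rewrite null_set_integral ?adde0 //.
- exact/measurableI/(discrete_measurable mT (fun y => y \notin _)).
- apply: (measurable_funS measurableT) => //.
  exact: (discrete_measurable_fun mT (EFin \o phi)).
- exact: step_leak.
Qed.

Definition grows (w : Omega) : Prop := forall n, (1 <= n)%N ->
  exists2 v, v \in verts (T n w) & T n.+1 w = graft n v (T n w).

Lemma grows_grown w n : (forall i, (1 <= i < n)%N ->
  exists2 v, v \in verts (T i w) & T i.+1 w = graft i v (T i w)) ->
  (1 <= n)%N -> grown n (T n w).
Proof.
case: hT => _ T1 _ _; elim: n => [//|[|n] IHn] h _; first by rewrite T1; constructor.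
have [v vt ->] := h n.+1 (ltnSn _); apply: GrownGraft => //; apply: IHn => // i /andP[i1 iN].
by apply: h; rewrite i1 ltnW.
Qed.

Lemma ae_grows : {ae P, forall w, grows w}.
Proof.
have step n i : {ae P, forall w, (1 <= n)%N -> cell hist n i w -> grown n (T n w) ->
    exists2 v, v \in verts (T n w) & T n.+1 w = graft n v (T n w)}.
  have [->|n1] := posnP n; first exact: aeW.
  have [e|/set0P[w1 [cw1 gw1]]] :=
    eqVneq (cell hist n i `&` [set w | grown n (T n w)]) set0.
    apply: aeW => w _ cw gw; have : set0 w by rewrite -e.
    by [].
  have [e|[s e]] := cell_cases hist n i; first by move: cw1; rewrite e.
  have es : s = hist n w1 by move: cw1; rewrite e.
  exists ([set w | hist n w = hist n w1] `&`
     [set w | T n.+1 w \notin [seq graft n v (T n w1) | v <- verts (T n w1)]]); split.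
  - apply: measurableI; first exact: hist_measurable.
    exact: (discrete_measurable (fun s => @T_measurable n.+1 s isT) (fun y => y \notin _)).
  - exact: step_leak.
  - move=> w /= bad; split.
      apply: contrapT => hw; apply: bad => _; rewrite e es => cw.
      by case: hw.
    apply/negP => /mapP[v vt wv]; apply: bad => _; rewrite e es => /= hw _.
    have ew : T n w = T n w1 by apply: (hist_T hw); rewrite n1 leqnn.
    by exists v; rewrite ew.
have all_steps : {ae P, forall w, forall n i, (1 <= n)%N -> cell hist n i w ->
    grown n (T n w) -> exists2 v, v \in verts (T n w) & T n.+1 w = graft n v (T n w)}.
  by apply: ae_foralln => n; apply: ae_foralln.
apply: filterS all_steps => w h n n1.
have hw m : (1 <= m)%N -> grown m (T m w) -> exists2 v, v \in verts (T m w) &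
    T m.+1 w = graft m v (T m w) by move=> m1; apply: (h m (pickle (hist m w))).
elim/ltn_ind: n n1 => n IHn n1; apply: hw => //; apply: grows_grown => // i /andP[i1 iN].
exact: IHn.
Qed.

Lemma growsT w n : grows w -> (1 <= n)%N -> grown n (T n w).
Proof. by move=> gw; apply: grows_grown => i /andP[i1 _]; apply: gw. Qed.

Lemma grows_extends w k n : grows w -> (1 <= k <= n)%N -> extends k (T k w) (T n w).
Proof.
move=> gw /andP[k1]; elim: n => [|n IHn]; first by rewrite leqn0 => /eqP e; rewrite e in k1.
rewrite leq_eqVlt => /orP[/eqP <-|kn]; first exact: extends_refl.
have n1 : (1 <= n)%N by rewrite (leq_trans k1).
have [v vt ->] := gw _ n1; apply: extends_graft => //; first exact: IHn.
by have [] := grown_wf (growsT gw n1).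
Qed.

(** On {T_k = t0} the process n |-> x(T_n) is a nonnegative supermartingale from time k
on.  The drift condition concerns grown trees only, since the other histories have
probability zero. *)
Lemma functional_cvg k t0 (x : tree -> R) : (1 <= k)%N -> (forall t, 0 <= x t) ->
  (forall n t, (k <= n)%N -> grown n t -> extends k t0 t ->
     mean_graft alpha theta n t x <= x t) ->
  {ae P, forall w, T k w = t0 -> cvgn (fun n => x (T n w))}.
Proof.
move=> k1 x0 drift.
pose F m w := hist (m + k) w.
(* time is shifted by k, and the process is killed off the event {T_k = t0} *)
pose X m w := if T k w == t0 then x (T (m + k)%N w) else 0.
have mF m s : measurable [set w | F m w = s] by exact: hist_measurable.
have FF m : determined F m.+1 (F m) by move=> w w'; exact: histS.
have X0 m w : 0 <= X m w by rewrite /X; case: ifP.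
have XF m : determined F m (X m).
  move=> w w' e; rewrite /X (hist_T e) ?k1 ?leq_addl //.
  by rewrite (hist_T e (i := (m + k)%N)) // leqnn andbT (leq_trans k1) // leq_addl.
have Xsuper m s : (\int[P]_(w in [set w | F m w = s]) (X m.+1 w)%:E
     <= \int[P]_(w in [set w | F m w = s]) (X m w)%:E)%E.
  have mX n D : measurable_fun D (EFin \o X n).
    apply: (measurable_funS measurableT) => //.
    exact/measurable_EFinP/(determined_measurable_fun mF (XF n)).
  have n1 : (1 <= m + k)%N by rewrite (leq_trans k1) // leq_addl.
  have [e|/set0P[w0 [ew0 gw0]]] := eqVneq ([set w | F m w = s] `&` grows) set0.
    have P0 : P [set w | F m w = s] = 0%E.
      apply/negligibleP; first exact: mF.
      apply: negligibleS ae_grows => w sw /= gw.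
      by have : set0 w by rewrite -e.
    rewrite (null_set_integral (mF m s) (mX m.+1 _) P0).
    by rewrite (null_set_integral (mF m s) (mX m _) P0).
  rewrite -ew0; have [tk|tk] := eqVneq (T k w0) t0; last first.
    have Xz n w : (m <= n)%N -> F m w = F m w0 -> X n w = 0.
      move=> mn /hist_T h; rewrite /X h ?(negbTE tk) //.
      by rewrite k1 leq_addl.
    rewrite !integral0_eq // => w /= hw; first by rewrite Xz.
    by rewrite Xz.
  have kk w : F m w = F m w0 -> T k w = t0.
    by move=> /hist_T ->; rewrite ?tk // k1 leq_addl.
  rewrite (eq_integral (fun w => (x (T (m + k).+1 w))%:E)); last first.
    by move=> w; rewrite inE /X => /= /kk ->; rewrite eqxx.
  rewrite (@step_integral (m + k) w0 x n1 (growsT gw0 n1) x0).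
  rewrite (eq_integral (fun w => (x (T (m + k) w0))%:E)); last first.
    move=> w; rewrite inE /X => /= hw; rewrite (kk _ hw) eqxx (hist_T hw) //.
    by rewrite n1 leqnn.
  rewrite integral_cst // muleC lee_wpmul2r // lee_fin.
  apply: drift; rewrite ?leq_addl //; first exact: growsT.
  by rewrite -tk; apply: grows_extends; rewrite // k1 leq_addl.
have XC : (\int[P]_w (X 0 w)%:E <= (x t0)%:E)%E.
  rewrite -[leRHS](_ : \int[P]_w (cst (x t0)%:E) w = _)%E; last first.
    by rewrite integral_cst //= probability_setT mule1.
  apply: ge0_le_integral => //.
  - by move=> w _; rewrite lee_fin.
  - exact/measurable_EFinP/(determined_measurable_fun mF (XF 0%N)).
  - by move=> w _; rewrite lee_fin /X; case: eqP => [<-|_].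
apply: filterS (supermartingale_cvg mF FF X0 XF Xsuper XC) => w + tk.
move=> /cvg_ex[l hl]; apply/cvg_ex; exists l.
rewrite -(cvg_shiftn k); apply: cvg_trans hl; apply: near_eq_cvg.
by near=> m; rewrite /X tk eqxx.
Unshelve. all: by end_near.
Qed.

End Growth.
(** * From supermartingale limits to edge lengths *)

Section Limits.
Variable R : realType.
Implicit Types (u y : nat -> R).

Lemma cvg_invn : (n%:R^-1 : R) @[n --> \oo] --> (0 : R).
Proof.
have h : \forall n \near \oo, (0 : R) < n%:R by exists 1%N => // n /= n1; rewrite ltr0n.
exact/(gtr0_cvgV0 h)/cvgr_idn.
Qed.

Lemma cvg_bounded_mul0 u y (B : R) : (forall n, 0 <= u n <= B) ->
  (forall n, 0 <= y n) -> y @ \oo --> (0 : R) -> u n * y n @[n --> \oo] --> (0 : R).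
Proof.
move=> uB y0 hy; apply: (@squeeze_cvgr _ _ _ _ (fun=> 0) (fun n => B * y n)).
- near=> n; have /andP[un unB] := uB n.
  by rewrite mulr_ge0 //= ler_wpM2r.
- exact: cvg_cst.
- by rewrite -(mulr0 B); apply: cvgMl_tmp.
Unshelve. all: by end_near. Qed.

Lemma cvg_powR (alpha l : R) y : 0 < alpha -> (forall n, 0 <= y n) ->
  y @ \oo --> l -> y n `^ alpha @[n --> \oo] --> l `^ alpha.
Proof.
move=> alpha0 y0 yl.
have l0 : 0 <= l.
  by rewrite -(cvg_lim _ yl) //; apply: limr_ge; [apply/cvg_ex; exists l|near=> n].
move: l0; rewrite le_eqVlt => /orP[/eqP l0|l0].
  rewrite -l0 powR0 ?gt_eqF //; apply/cvgrPdist_lt => e e0.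
  (* y ^ alpha < e as soon as y < e ^ (1 / alpha) *)
  have e'0 : 0 < e `^ alpha^-1 by rewrite powR_gt0.
  move/cvgrPdist_lt : yl => /(_ _ e'0); apply: filterS => n.
  rewrite -l0 !sub0r !normrN !ger0_norm ?powR_ge0 // => yn.
  rewrite -[ltRHS](powRr1 (ltW e0)) -(mulVf (lt0r_neq0 alpha0)) powRrM.
  by rewrite gt0_ltr_powR // nnegrE // powR_ge0.
have cont : {for l, continuous (fun x : R => x `^ alpha)}; last exact: (continuous_cvg _ cont yl).
apply: differentiable_continuous; apply/derivable1_diffP; apply: derivable_powR.
by rewrite in_itv /= andbT.
Unshelve. all: by end_near. Qed.

Lemma invr_powR (n : nat) (alpha : R) : n%:R `^ (- alpha) = (n%:R^-1 : R) `^ alpha.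
Proof. by rewrite -(powR_inv1 (ler0n R n)) -powRrM mulN1r. Qed.

Lemma cvg_powRN (alpha : R) : 0 < alpha -> n%:R `^ (- alpha) @[n --> \oo] --> (0 : R).
Proof.
move=> alpha0; rewrite -[X in _ --> X](powR0 (lt0r_neq0 alpha0)).
under eq_cvg do rewrite invr_powR.
by apply: (cvg_powR alpha0 _ cvg_invn) => n; rewrite invr_ge0.
Qed.

(** Solve the definition of the potential for the length; truncating at 2 and m changes
the numbers by a bounded amount, which is negligible after division. *)
Lemma cvg_spine_length (alpha theta c : R) (N l : nat -> nat) (m : nat) :
  0 < alpha -> 0 <= theta ->
  cvgn (fun n => (N n)%:R / n%:R : R) ->
  cvgn (fun n => potential alpha theta c (maxn (N n) 2) (maxn (l n) m)) ->
  cvgn (fun n => n%:R `^ (- alpha) * (l n)%:R : R).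
Proof.
move=> alpha0 theta0 /cvg_ex[/= x hx] /cvg_ex[/= p hp].
pose z n : R := (maxn (N n) 2)%:R - 2 + theta + alpha.
have z0 n : 0 < z n.
  have : 2 <= (maxn (N n) 2)%:R :> R by rewrite ler_nat leq_maxr.
  by rewrite /z; move: alpha0 theta0; lra.
have inv0 n : 0 <= n%:R^-1 :> R by rewrite invr_ge0.
have zx : z n / n%:R @[n --> \oo] --> x.
  have -> : (fun n => z n / n%:R) = (fun n => (N n)%:R / n%:R +
      (((maxn (N n) 2)%:R - (N n)%:R) * n%:R^-1 + (theta + alpha - 2) * n%:R^-1)).
    by apply/funext => n; rewrite /z; ring.
  rewrite -[X in _ --> X]addr0; apply: cvgD => //; rewrite -[X in _ --> X]addr0.
  apply: cvgD; last by rewrite -(mulr0 (theta + alpha - 2)); apply: cvgMl_tmp; exact: cvg_invn.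
  apply: (@cvg_bounded_mul0 (fun n => (maxn (N n) 2)%:R - (N n)%:R) _ 2) => //; last exact: cvg_invn.
  move=> n; rewrite subr_ge0 ler_nat leq_maxl /= lerBlDl -natrD ler_nat; lia.
have pow0 n : 0 <= n%:R `^ (- alpha) :> R by rewrite powR_ge0.
have e0 : ((maxn (l n) m)%:R - (l n)%:R) * n%:R `^ (- alpha) @[n --> \oo] --> (0 : R).
  apply: (@cvg_bounded_mul0 (fun n => (maxn (l n) m)%:R - (l n)%:R) _ m%:R) => //.
    move=> n; rewrite subr_ge0 ler_nat leq_maxl /= lerBlDl -natrD ler_nat; lia.
  exact: cvg_powRN.
have -> : (fun n => n%:R `^ (- alpha) * (l n)%:R : R) = (fun n =>
   alpha^-1 * (potential alpha theta c (maxn (N n) 2) (maxn (l n) m) *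
                (z n / n%:R) `^ alpha - c * n%:R `^ (- alpha))
   - ((maxn (l n) m)%:R - (l n)%:R) * n%:R `^ (- alpha)).
  apply/funext => n; rewrite powRM ?inv0 ?(ltW (z0 n)) // -invr_powR.
  rewrite /potential -/(z n).
  have : z n `^ alpha != 0 by rewrite gt_eqF // powR_gt0.
  move: (_ `^ _) (_ `^ _) => q r r0; field; rewrite r0 gt_eqF //.
apply/cvg_ex; eexists; apply: cvgB; last exact: e0.
apply: cvgMl_tmp; apply: cvgB; last exact: cvgMl_tmp (cvg_powRN alpha0).
apply: cvgM; first exact: hp.
apply: cvg_powR => //; last exact: zx.
by move=> n; rewrite divr_ge0 // ltW.
Qed.

End Limits.

Section Main.
Context (d : measure_display) (R : realType) (Omega : measurableType d).
Variables (P : probability Omega R) (alpha theta : R) (T : nat -> Omega -> tree).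
Hypotheses (alpha0 : 0 < alpha) (alpha1 : alpha < 1) (theta0 : 0 <= theta).
Hypothesis hT : tree_growth_process P alpha theta T.
Variables (k : nat) (k1 : (1 <= k)%N) (t0 : tree).
Hypothesis gt0 : grown k t0.

Let nt0 : all (named_by k) (verts t0).
Proof. by have [] := grown_wf gt0. Qed.

Lemma planted_functional_cvg a s f (x : tree -> R) : planted t0 a s f ->
  (forall t, 0 <= x t) ->
  (forall n t, (k <= n)%N -> extends k s t -> uniq (verts t) ->
     mean_graft alpha theta n t x <= x t) ->
  {ae P, forall w, T k w = t0 -> cvgn (fun n => x (f (T n w)))}.
Proof.
move=> pf x0 drift.
apply: (@functional_cvg _ _ _ _ _ _ _ theta0 hT k t0 (fun t => x (f t)) k1
  (fun t => x0 (f t))) => n t kn gt et.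
have [ut _ _] := grown_wf gt.
have [ef uf _] := planted_extends nt0 pf et ut.
have [q q0 ->] := planted_mean_graft alpha1 theta0 nt0 pf et ut kn.
have := ler_wpM2l q0 (drift n (f t) kn ef uf); lra.
Qed.

Lemma fraction_ge0 (g : tree -> tree) (s s' : tree) t :
  0 <= fraction theta g (weight_const alpha theta s s') t.
Proof.
have h u : 1 <= (nleaves u)%:R :> R by rewrite ler1n nleaves_gt0.
have := h (g t); have := h t; rewrite /fraction /weight_const => ht hg.
by apply: divr_ge0; move: theta0 alpha1; [case: ifP => _; lra|lra].
Qed.

(** Induction from the root: the fraction of leaves above a branch point that lie in
one of its subtrees converges, because the compensated fraction is a
martingale. *)
Lemma planted_nleaves_cvg a s f : planted t0 a s f ->
  {ae P, forall w, T k w = t0 -> cvgn (fun n => (nleaves (f (T n w)))%:R / n%:R : R)}.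
Proof.
have step a' b s1 s1' g f' (c : R) : planted t0 a' (TNode b s1 s1') f' ->
    {ae P, forall w, T k w = t0 -> cvgn (fun n => (nleaves (f' (T n w)))%:R / n%:R : R)} ->
    (forall t, 0 <= fraction theta g c t) ->
    (forall n t, (k <= n)%N -> extends k (TNode b s1 s1') t -> uniq (verts t) ->
      mean_graft alpha theta n t (fraction theta g c) <= fraction theta g c t) ->
    {ae P, forall w, T k w = t0 -> cvgn (fun n => (nleaves (g (f' (T n w))))%:R / n%:R : R)}.
  move=> pf' IH c0 drift.
  have := planted_functional_cvg pf' c0 drift.
  apply: filterS3 (ae_grows theta0 hT) IH => w gw IH h tk.
  have /cvg_ex[/= x hx] := IH tk; have /cvg_ex[/= y hy] := h tk.
  apply/cvg_ex; exists (y * x).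
  have hz : fraction theta g c (f' (T n w)) * ((nleaves (f' (T n w)))%:R / n%:R
      + (theta - 1) * n%:R^-1) - c * n%:R^-1 @[n --> \oo] --> y * x.
    rewrite -[y * x]subr0; apply: cvgB; last first.
      by rewrite -(mulr0 c); apply: cvgMl_tmp; exact: cvg_invn.
    apply: cvgM => //; rewrite -[x]addr0; apply: cvgD => //.
    by rewrite -(mulr0 (theta - 1)); apply: cvgMl_tmp; exact: cvg_invn.
  apply: cvg_trans hz; apply: near_eq_cvg.
  near=> n; have kn : (k <= n)%N by near: n; exact: nbhs_infty_ge.
  have et : extends k t0 (T n w).
    by rewrite -tk; apply: (grows_extends hT gw); rewrite k1.
  have [ut _ _] := grown_wf (growsT hT gw (leq_trans k1 kn)).
  have [ef _ _] := planted_extends nt0 pf' et ut.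
  have D0 : 0 < (nleaves (f' (T n w)))%:R - 1 + theta.
    by inversion ef; apply: node_denominator_gt0.
  have m0 : n%:R != 0 :> R by rewrite pnatr_eq0 -lt0n (leq_trans k1).
  move: D0 m0; rewrite /fraction /=; move: n%:R (nleaves _)%:R (nleaves _)%:R.
  by move=> r D N D0 r0; field; rewrite r0 gt_eqF.
elim=> {a s f} [|a b s s' f pf IH|a b s s' f pf IH].
- apply: filterS (ae_grows theta0 hT) => w gw _.
  apply/cvg_ex; exists 1.
  have h : (fun n : nat => 1 : R) @ \oo --> (1 : R) by exact: cvg_cst.
  apply: cvg_trans h; apply: near_eq_cvg; near=> n.
  have n1 : (1 <= n)%N by near: n; exact: nbhs_infty_ge.
  have [_ -> _] := grown_wf (growsT hT gw n1).
  by rewrite divff // pnatr_eq0 -lt0n.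
- apply: (step _ _ _ _ _ _ _ pf IH (fraction_ge0 _ s s')) => n t kn et ut.
  by rewrite (mean_graft_fraction alpha theta0 et (planted_named nt0 pf) ut kn).1.
- apply: (step _ _ _ _ _ _ _ pf IH (fraction_ge0 _ s' s)) => n t kn et ut.
  by rewrite (mean_graft_fraction alpha theta0 et (planted_named nt0 pf) ut kn).2.
Unshelve. all: by end_near. Qed.

Lemma reduced_length_cvg e : e \in edges t0 ->
  {ae P, forall w, T k w = t0 ->
    cvgn (fun n => n%:R `^ (- alpha) * (reduced_length (T n w) e)%:R : R)}.
Proof.
move=> /(planted_edges_from (PlantedRoot t0))[s [f [pf top_s]]].
have ns := planted_named nt0 pf.
have drift n t (kn : (k <= n)%N) (et : extends k s t) (ut : uniq (verts t)) :=
  mean_graft_spine_potential alpha0 alpha1 theta0 et ns ut kn.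
have := planted_functional_cvg pf (spine_potential_ge0 alpha0 theta0 (top s)) drift.
apply: filterS3 (ae_grows theta0 hT) (planted_nleaves_cvg pf) => w gw hN hp tk.
have /cvg_ex[/= x hx] := cvg_spine_length alpha0 theta0 (hN tk) (hp tk).
apply/cvg_ex; exists x; apply: cvg_trans hx; apply: near_eq_cvg.
near=> n; have kn : (k <= n)%N by near: n; exact: nbhs_infty_ge.
congr (_ * _%:R).
have et : extends k t0 (T n w).
  by rewrite -tk; apply: (grows_extends hT gw); rewrite k1.
have [ut _ _] := grown_wf (growsT hT gw (leq_trans k1 kn)).
have [ef uf sub] := planted_extends nt0 pf et ut.
by rewrite /reduced_length -top_s (graph_dist_spine ut uf sub ef ns).
Unshelve. all: by end_near. Qed.

End Main.

Theorem proposition2 (d : measure_display) (R : realType)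
    (Omega : measurableType d) (P : probability Omega R) (alpha theta : R)
    (T : nat -> Omega -> tree)
    (halpha0 : 0 < alpha) (halpha1 : alpha < 1) (htheta : 0 <= theta)
    (hT : tree_growth_process P alpha theta T)
    (k : nat) (hk : (1 <= k)%N) :
  exists L : edge -> {RV P >-> R},
    (forall e w, 0 <= L e w) /\
    {ae P, forall w, forall e : edge, e \in edges (T k w) ->
      n%:R `^ (- alpha) * (reduced_length (T n w) e)%:R @[n --> \oo] --> L e w}.
Proof.
pose u e n w : R := n%:R `^ (- alpha) * (reduced_length (T n w) e)%:R.
(* the upper limit is measurable and agrees with the limit wherever that exists; the
   shift by one avoids T 0, which need not be measurable *)
pose L e w : R := fine (limn_esup (fun n => (u e n.+1 w)%:E)).
have u0 e n w : 0 <= u e n w by rewrite mulr_ge0 // powR_ge0.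
have L0 e w : 0 <= L e w.
  apply: fine_ge0; rewrite limn_esup_lim; apply: lime_ge; first exact: is_cvg_esups.
  exists 0%N => // n _; apply: le_trans (_ : ((u e n.+1 w)%:E <= _)%E).
    by rewrite lee_fin.
  by apply: ereal_sup_ubound; exists n => /=.
have mu e n : measurable_fun setT (u e n.+1).
  exact: (discrete_measurable_fun (fun t => T_measurable hT t (ltn0Sn n))
    (fun t => n.+1%:R `^ (- alpha) * (reduced_length t e)%:R)).
have mL e : measurable_fun setT (L e).
  apply: (measurableT_comp (fine_measurable measurableT)).
  apply: (@measurable_fun_limn_esup _ _ _ setT (fun n w => (u e n.+1 w)%:E)) => n.
  exact/measurable_EFinP.
exists (fun e => mfun_Sub (mem_set (mL e) : L e \in mfun)); split; first exact: L0.
have all_cvg : {ae P, forall w, forall i,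
    if @unpickle (tree * edge)%type i is Some (t0, e) then
      e \in edges t0 -> T k w = t0 -> cvgn (fun n => u e n w) else True}.
  apply: ae_foralln => i; case: (unpickle i) => [[t0 e]|]; last exact: aeW.
  have [et|_] := boolP (e \in edges t0); last exact: aeW.
  have [g|ng] := pselect (grown k t0).
    by apply: filterS (reduced_length_cvg halpha0 halpha1 htheta hT hk g et) => w h _.
  apply: filterS (ae_grows htheta hT) => w gw _ tk; case: ng.
  by rewrite -tk; exact: (growsT hT gw hk).
apply: filterS all_cvg => w hw e ee.
have := hw (pickle (T k w, e)); rewrite pickleK => /(_ ee erefl) /cvg_ex[/= l hl].
rewrite -[X in _ --> X]/(L e w) (_ : L e w = l) //.
have hl' : (u e n.+1 w)%:E @[n --> \oo] --> l%:E.
  by apply: cvg_EFin; [near=> n|rewrite (cvg_shiftS (fun n => u e n w))].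
by rewrite /L (cvg_limn_einf_sup hl').2.
Unshelve. all: by end_near. Qed.
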